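(* A smooth family of algebras $\mathcal A\to\Delta$ determines a smooth family of projective geometries $\mathcal A\mathsf P^n\to\Delta$ for each $n\in\mathbb N$; that is, the pair $(\mathcal{GL}(n+1;\mathcal A),\mathcal{St}(n+1;\mathcal A))$, whose member over $\delta\in\Delta$ is the $n$-dimensional projective geometry over $\mathcal A_\delta$, is a smooth family of geometries over $\Delta$.
   Context: A smooth family of algebras over a smooth manifold $\Delta$ is a (finite rank) real vector bundle $\mathcal A\to\Delta$ with a smooth fiberwise-bilinear multiplication $\mathcal A\times_\Delta\mathcal A\to\mathcal A$ and smooth unit section making each fiber $\mathcal A_\delta$ a finite-dimensional associative unital real algebra. For such an algebra $A$, $\mathrm{St}(n+1;A)=\left\{\left(\begin{smallmatrix}X&\vec 0\\ \vec v&\alpha\end{smallmatrix}\right): X\in\mathrm{GL}(n;A),\ \vec v\in A^{n},\ \alpha\in A^\times\right\}\subset\mathrm{GL}(n+1;A)$ is the projective stabilizer of $(0,\dots,0,1)$. The $n$-dimensional projective geometry over $A$ is the homogeneous geometry given by the pair (automorphism group, point stabilizer) $(\mathrm{GL}(n+1;A),\mathrm{St}(n+1;A))$, with underlying space $A\mathsf P^n=\mathrm{GL}(n+1;A)/\mathrm{St}(n+1;A)$. Put $\mathcal{GL}(n+1;\mathcal A)=\bigcup_\delta\mathrm{GL}(n+1;\mathcal A_\delta)$ and $\mathcal{St}(n+1;\mathcal A)=\bigcup_\delta\mathrm{St}(n+1;\mathcal A_\delta)$, both subsets of the vector bundle $\bigcup_\delta\mathrm M(n+1;\mathcal A_\delta)$.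 A smooth family over $\Delta$ is a smooth manifold with a smooth submersion to $\Delta$; a subfamily is a closed submanifold on which the projection is still a submersion; a family of groups is a smooth family with smooth identity section and smooth fiberwise multiplication and inversion making each fiber a Lie group. A smooth family of geometries over $\Delta$ is a pair $(\mathcal G,\mathcal C)$ of a family of groups $\mathcal G\to\Delta$ and a closed subfamily of subgroups $\mathcal C\le\mathcal G$. *)

(* Defs.v *)
From HB Require Import structures.
From mathcomp Require Import all_boot all_order all_algebra.
From mathcomp Require Import all_classical all_reals all_analysis.

Set Implicit Arguments.
Unset Strict Implicit.
Unset Printing Implicit Defensive.
Import Order.TTheory GRing.Theory Num.Theory.
Import numFieldNormedType.Exports.
Local Open Scope classical_set_scope.
Local Open Scope ring_scope.

(** * Smooth maps between open subsets of Euclidean spaces *)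

Section Euclidean.
Context {R : realType}.

(* [Ck k U h] and [smooth_on U h] are only used for [U] open. *)
Fixpoint Ck (d m k : nat) (U : set 'rV[R]_d) (h : 'rV[R]_d -> 'rV[R]_m) : Prop :=
  if k is k'.+1 then
    (forall x, U x -> differentiable h x) /\
    (forall v, Ck k' U (fun x => 'd h x v))
  else forall x, U x -> {for x, continuous h}.

Definition smooth_on d m (U : set 'rV[R]_d) (h : 'rV[R]_d -> 'rV[R]_m) : Prop :=
  forall k, Ck k U h.

End Euclidean.

(** * Smooth manifolds

   A manifold is a set with a smooth atlas, and carries the topology determined
   by the atlas.  Charts are not required to have the same dimension, so that
   the dimension of a manifold (and the rank of a vector bundle) is locally
   constant.  Charts, and sets with charts, are bare data here; the axioms are
   collected in [smooth_manifold]. *)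

Record chart (R : realType) (T : Type) := Chart {
  cdim : nat;
  cdom : set T;
  cmap :> T -> 'rV[R]_cdim
}.

Record charted (R : realType) := Charted {
  point :> Type;
  atlas : set (chart R point)
}.
Arguments Charted {R point} atlas.

Section Manifolds.
Context {R : realType}.
Implicit Types M N : charted R.

Definition is_chart T (c : chart R T) : Prop :=
  {in cdom c &, injective c} /\ open (c @` cdom c).

(* The coordinate change [c' \o c^-1] is smooth on its domain, which is open. *)
Definition smooth_change T (c c' : chart R T) : Prop :=
  open (c @` (cdom c `&` cdom c')) /\
  exists h, smooth_on (c @` (cdom c `&` cdom c')) h /\
    forall x, cdom c x -> cdom c' x -> c' x = h (c x).

Definition compatible T (c c' : chart R T) : Prop :=
  smooth_change c c' /\ smooth_change c' c.

Definition mopen M (U : set M) : Prop :=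
  forall c, atlas c -> open (c @` (cdom c `&` U)).

Definition mclosed M (F : set M) : Prop := mopen (~` F).

Definition mhausdorff M : Prop :=
  forall x y : M, x <> y ->
    exists U V : set M, [/\ mopen U, mopen V, U x, V y & U `&` V = set0].

Definition msecond_countable M : Prop :=
  exists B : nat -> set M, (forall i, mopen (B i)) /\
    forall (U : set M) x, mopen U -> U x -> exists i, B i x /\ B i `<=` U.

Definition smooth_manifold M : Prop :=
  [/\ forall c : chart R M, atlas c -> is_chart c,
      forall x : M, exists2 c, atlas c & cdom c x,
      forall c c' : chart R M, atlas c -> atlas c' -> compatible c c',
      mhausdorff M
    & msecond_countable M].

(* Membership in the maximal atlas. *)
Definition admissible M (c : chart R M) : Prop :=
  is_chart c /\ forall c', atlas c' -> compatible c c'.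

(* Near [x], the map [f] reads [h] in the charts [c] and [c'], where [h] is
   smooth on an open neighbourhood [W] of [c x]. *)
Definition local_rep M N (f : M -> N) (x : M) (c : chart R M) (c' : chart R N)
    (W : set 'rV[R]_(cdim c)) (h : 'rV[R]_(cdim c) -> 'rV[R]_(cdim c')) : Prop :=
  [/\ atlas c /\ atlas c',
      cdom c x /\ W (c x),
      open W /\ W `<=` c @` cdom c,
      forall y, cdom c y -> W (c y) -> cdom c' (f y) /\ c' (f y) = h (c y)
    & smooth_on W h].

Definition smooth_at M N (f : M -> N) (x : M) : Prop :=
  exists c c' W h, @local_rep M N f x c c' W h.

Definition smooth M N (f : M -> N) : Prop := forall x, smooth_at f x.

Definition submersion M N (f : M -> N) : Prop :=
  forall x, exists c c' W h,
    @local_rep M N f x c c' W h /\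
    (forall v : 'rV[R]_(cdim c'), exists u, 'd h (c x) u = v).

Definition euclidean (r : nat) : charted R :=
  Charted [set Chart setT (@id 'rV[R]_r)].

Definition product M N : charted R :=
  Charted [set c : chart R (M * N) |
    exists (a : chart R M) (b : chart R N), [/\ atlas a, atlas b &
      c = Chart (cdom a `*` cdom b) (fun p => row_mx (a p.1) (b p.2))]].

(** ** Submanifolds *)

(* The chart with domain [D] and map [phi] straightens the subset [S] to the
   slice where the last [l] coordinates vanish. *)
Definition slice_chart M (S : set M) k l (D : set M) (phi : M -> 'rV[R]_(k + l)) :
    Prop :=
  admissible (Chart D phi) /\ forall p, D p -> (S p <-> rsubmx (phi p) = 0).

Definition submanifold M (S : set M) : Prop :=
  forall p, S p -> exists k l D (phi : M -> 'rV[R]_(k + l)),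
    D p /\ slice_chart S D phi.

(* The structure on [T] for which an injection [i] of [T] into [M], whose range
   is a submanifold, is an embedding. *)
Definition induced M T (i : T -> M) : charted R :=
  Charted [set c : chart R T |
    exists k l D (phi : M -> 'rV[R]_(k + l)), slice_chart (range i) D phi /\
      c = Chart (i @^-1` D) (fun t => lsubmx (phi (i t)))].

Definition subspace_of M (S : set M) : charted R := induced (@sval M S).

End Manifolds.

(** * Families

   A family over [Delta] is given by its fibers [F : Delta -> Type] and by
   charts on the total space [{delta & F delta}]. *)

Section Families.
Context {R : realType}.
Implicit Types Delta : charted R.

Definition total Delta (F : Delta -> Type) (E : set (chart R {delta & F delta})) :
  charted R := Charted E.

Definition proj Delta (F : Delta -> Type) (E : set (chart R {delta & F delta})) :
  total E -> Delta := @tag Delta F.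

Definition smooth_family Delta (F : Delta -> Type)
    (E : set (chart R {delta & F delta})) : Prop :=
  [/\ smooth_manifold Delta, smooth_manifold (total E) & submersion (proj (E := E))].

Definition closed_subfamily Delta (F : Delta -> Type)
    (E : set (chart R {delta & F delta})) (C : forall delta, set (F delta)) : Prop :=
  let S : set (total E) := [set p | C (tag p) (tagged p)] in
  [/\ mclosed S, submanifold S
    & submersion (fun p : subspace_of S => proj (sval p))].

(* The fibered product of the total space with itself, as a submanifold of the
   product. *)
Definition fibered_square Delta (F : Delta -> Type)
    (E : set (chart R {delta & F delta})) : charted R :=
  induced (fun p : {delta & (F delta * F delta)%type} =>
    ((Tagged F (tagged p).1, Tagged F (tagged p).2) : product (total E) (total E))).

Definition fiber Delta (F : Delta -> Type)
    (E : set (chart R {delta & F delta})) (delta : Delta) : charted R :=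
  induced (fun x : F delta => (Tagged F x : total E)).

(* A smooth local trivialization over [U] of rank [r]; [Phi] and [Psi] are
   relevant only over [U]. *)
Definition local_trivialization Delta (F : Delta -> lmodType R)
    (E : set (chart R {delta & F delta})) (U : set Delta) (r : nat)
    (Phi : forall delta, F delta -> 'rV[R]_r)
    (Psi : forall delta, 'rV[R]_r -> F delta) : Prop :=
  [/\ mopen U,
      forall delta, U delta -> linear (Phi delta),
      forall delta, U delta ->
        cancel (Phi delta) (Psi delta) /\ cancel (Psi delta) (Phi delta),
      forall e : total E, U (tag e) ->
        smooth_at (fun e : total E =>
          ((tag e, Phi _ (tagged e)) : product Delta (euclidean r))) e
    & forall p : product Delta (euclidean r), U p.1 ->
        smooth_at (fun p : product Delta (euclidean r) =>
          (Tagged F (Psi p.1 p.2) : total E)) p].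

Definition vector_bundle Delta (F : Delta -> lmodType R)
    (E : set (chart R {delta & F delta})) : Prop :=
  [/\ smooth_manifold Delta, smooth_manifold (total E), smooth (proj (E := E))
    & forall delta, exists U r Phi Psi,
        U delta /\ @local_trivialization Delta F E U r Phi Psi].

End Families.

(** * Families of algebras *)

(* Associative unital algebras.  Unlike [algType], this includes the zero
   algebra; no structure of the library combines [pzRingType] and [lmodType]. *)
Record algebra (R : pzRingType) := MkAlgebra {
  alg_lmod : lmodType R;
  alg_one : alg_lmod;
  alg_mul : alg_lmod -> alg_lmod -> alg_lmod;
  alg_mulA : associative alg_mul;
  alg_mul1 : left_id alg_one alg_mul;
  alg_mulr1 : right_id alg_one alg_mul;
  alg_mulDl : left_distributive alg_mul +%R;
  alg_mulDr : right_distributive alg_mul +%R;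
  alg_scalerAl : forall k x y, k *: alg_mul x y = alg_mul (k *: x) y;
  alg_scalerAr : forall k x y, k *: alg_mul x y = alg_mul x (k *: y)
}.

Definition alg_sort (R : pzRingType) (A : algebra R) : Type := alg_lmod A.
Coercion alg_sort : algebra >-> Sortclass.

HB.instance Definition _ (R : pzRingType) (A : algebra R) :=
  GRing.Lmodule.copy (alg_sort A) (alg_lmod A).
HB.instance Definition _ (R : pzRingType) (A : algebra R) :=
  GRing.Zmodule_isPzRing.Build (alg_sort A) (@alg_mulA R A) (@alg_mul1 R A)
    (@alg_mulr1 R A) (@alg_mulDl R A) (@alg_mulDr R A).

Section FamiliesOfAlgebras.
Context {R : realType}.
Implicit Types Delta : charted R.

(* Finite-dimensionality of the fibers is part of [vector_bundle]. *)
Definition smooth_family_of_algebras Delta (A : Delta -> algebra R)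
    (E : set (chart R {delta & A delta})) : Prop :=
  [/\ @vector_bundle R Delta (fun delta => A delta) E,
      smooth (fun p : fibered_square E =>
        (Tagged A ((tagged p).1 * (tagged p).2) : total E))
    & smooth (fun delta : Delta => (Tagged A (1 : A delta) : total E))].

(* The vector bundle of [N x N] matrices: a local trivialization of the bundle
   of algebras, applied to each entry, and a chart of the base give a chart. *)
Definition matrix_bundle Delta (A : Delta -> algebra R)
    (E : set (chart R {delta & A delta})) (N : nat) :
    set (chart R {delta & 'M[A delta]_N}) :=
  [set c | exists (b : chart R Delta) U r Phi Psi,
    [/\ atlas b, @local_trivialization R Delta (fun delta => A delta) E U r Phi Psi
      & c = Chart [set p | cdom b (tag p) /\ U (tag p)]
          (fun p => row_mx (b (tag p))
             (mxvec (\matrix_(k < N * N, l < r)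
                       Phi (tag p) (mxvec (tagged p) 0 k) 0 l)))]].

End FamiliesOfAlgebras.
Arguments matrix_bundle {R Delta A} E N.

(** * The general linear group *)

Definition invertible (A : pzRingType) (x : A) : Prop :=
  exists y, y * x = 1 /\ x * y = 1.

Definition GL (A : pzRingType) (N : nat) : Type := {g : 'M[A]_N | invertible g}.

Section GLGroup.
Variables (A : pzRingType) (N : nat).
Implicit Types g h : GL A N.

Lemma GL_inj g h : sval g = sval h -> g = h.
Proof. by case: g h => [g ?] [h ?] /= eq_gh; apply: eq_exist. Qed.

Lemma GL1_subproof : invertible (1 : 'M[A]_N).
Proof. by exists 1; rewrite mulr1. Qed.

Lemma GLM_subproof g h : invertible (sval g * sval h).
Proof.
case: g h => [g [g' [g'g gg']]] [h [h' [h'h hh']]] /=; exists (h' * g'); split.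
  by rewrite mulrA -(mulrA h') g'g mulr1.
by rewrite mulrA -(mulrA g) hh' mulr1.
Qed.

Lemma GLV_subproof g : invertible (sval (cid (svalP g))).
Proof. by case: cid => g' [? ?] /=; exists (sval g). Qed.

Definition GL1 : GL A N := exist _ 1 GL1_subproof.
Definition GLM g h : GL A N := exist _ (sval g * sval h) (GLM_subproof g h).
Definition GLV g : GL A N := exist _ (sval (cid (svalP g))) (GLV_subproof g).

Lemma GL_mulA : associative GLM.
Proof. by move=> x y z; apply: GL_inj; rewrite /= mulrA. Qed.

Lemma GL_mul1 : left_id GL1 GLM.
Proof. by move=> x; apply: GL_inj; rewrite /= mul1r. Qed.

Lemma GL_mulr1 : right_id GL1 GLM.
Proof. by move=> x; apply: GL_inj; rewrite /= mulr1. Qed.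

Lemma GL_mulV : left_inverse GL1 GLV GLM.
Proof. by move=> x; apply: GL_inj; rewrite /=; case: cid => ? []. Qed.

Lemma GL_mulrV : right_inverse GL1 GLV GLM.
Proof. by move=> x; apply: GL_inj; rewrite /=; case: cid => ? []. Qed.

HB.instance Definition _ := gen_eqMixin (GL A N).
HB.instance Definition _ := gen_choiceMixin (GL A N).
HB.instance Definition _ := isGroup.Build (GL A N)
  GL_mulA GL_mul1 GL_mulr1 GL_mulV GL_mulrV.

End GLGroup.

(* The stabilizer of the last coordinate point. *)
Definition St (A : pzRingType) (n : nat) : set (GL A (n + 1)) :=
  [set g | exists (X : 'M[A]_n) (v : 'rV[A]_n) (alpha : A),
    [/\ invertible X, invertible alpha & sval g = block_mx X 0 v alpha%:M]].

(** * Families of groups and of geometries *)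

Record geometry := Geometry {
  aut : groupType;
  stab : set aut
}.

Definition projective_geometry (A : pzRingType) (n : nat) : geometry :=
  @Geometry (GL A (n + 1)) (@St A n).

Section FamiliesOfGeometries.
Context {R : realType}.
Implicit Types Delta : charted R.

Definition lie_group (G : groupType) (L : set (chart R G)) : Prop :=
  [/\ smooth_manifold (Charted L),
      smooth (fun p : product (Charted L) (Charted L) =>
        ((p.1 * p.2)%g : Charted L))
    & smooth (fun g : Charted L => ((g : G)^-1%g : Charted L))].

Definition smooth_family_of_groups Delta (G : Delta -> groupType)
    (L : set (chart R {delta & G delta})) : Prop :=
  [/\ smooth_family L,
      smooth (fun delta : Delta => (Tagged G (1%g : G delta) : total L)),
      smooth (fun p : fibered_square L =>
        (Tagged G ((tagged p).1 * (tagged p).2)%g : total L)),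
      smooth (fun g : total L => (Tagged G (tagged g)^-1%g : total L))
    & forall delta, @lie_group (G delta) (@atlas R (fiber L delta))].

Definition is_subgroup (G : groupType) (C : set G) : Prop :=
  [/\ C 1%g, forall x y, C x -> C y -> C (x * y)%g & forall x, C x -> C x^-1%g].

Definition smooth_family_of_geometries Delta (P : Delta -> geometry)
    (L : set (chart R {delta & aut (P delta)})) : Prop :=
  [/\ @smooth_family_of_groups Delta (fun delta => aut (P delta)) L,
      @closed_subfamily R Delta (fun delta => aut (P delta)) L
        (fun delta => @stab (P delta))
    & forall delta, is_subgroup (@stab (P delta))].

(* The smooth structure on the union of the groups [GL N (A delta)], as a
   submanifold of the bundle of matrices. *)
Definition GL_family Delta (A : Delta -> algebra R)
    (E : set (chart R {delta & A delta})) (N : nat) :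
    set (chart R {delta & GL (A delta) N}) :=
  atlas (c := induced (fun g : {delta & GL (A delta) N} =>
    (Tagged (fun delta => 'M[A delta]_N) (sval (tagged g))
      : total (matrix_bundle E N)))).

End FamiliesOfGeometries.
Arguments GL_family {R Delta A} E N.

(* Main.v *)
Require Import Defs.
From HB Require Import structures.
From mathcomp Require Import all_boot all_order all_algebra.
From mathcomp Require Import all_classical all_reals all_analysis.
(* Imported again so that [induced] denotes the structure of a submanifold. *)
Require Import Defs.
Set Implicit Arguments.
Unset Strict Implicit.
Unset Printing Implicit Defensive.
Import Order.TTheory GRing.Theory Num.Theory.
Import numFieldNormedType.Exports.
Local Open Scope classical_set_scope.
Local Open Scope ring_scope.

(** An open set [U] of the base over which the bundle is trivial turns the family
   of algebras into [U] times a fixed vector space with structure constants that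
   are smooth functions on [U] ([structure_constant_smooth]).  In the coordinates
   given by the entries, multiplication of matrices is therefore polynomial with
   smooth coefficients ([mx_smooth_mul]).  Left multiplication by a matrix [X] is a
   square real matrix [lmul_mx X] with smooth entries, and because the algebras are
   finite-dimensional, [X] is invertible if and only if this real matrix is
   ([invertible_lmul]).  So the general linear groups form an open subset of the
   bundle of matrices ([GL_open]), and the inverse of [X], which is the solution [Z]
   of [X * Z = 1], is smooth by Cramer's rule ([mx_smooth_inv]).

   The charts of the total spaces that arise extend charts of the base; they are
   called [adapted].  In an adapted chart the projection is a linear projection,
   so it is a submersion ([tag_submersion]), and the fibers and the fibered
   square are affine slices ([fiber_submanifold], [fibered_pair_submanifold]).
   So are the subsets that are defined by the vanishing of coordinates along the
   fibers, and these are closed subfamilies ([coordinate_subfamily]).  The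
   stabilizers are of this kind: over a finite-dimensional algebra, an invertible
   matrix whose upper right block is zero has invertible diagonal blocks
   ([St_ursubmx]).

   Smoothness of maps between manifolds is reduced to that of real-valued
   functions: a map is smooth at a point if and only if its coordinates in some
   admissible chart are ([smooth_at_adm]).  Real-valued functions that are smooth
   at a point can be computed with in any admissible chart ([rsmooth_adm]), and
   form a ring that is closed under composition with smooth functions, so that
   determinants and inverses of matrices of smooth functions are smooth
   ([rsmooth_invmx]). *)

(** * Real-valued functions of class C^k *)

Section DiffNear.
Context {R : realType} {V W : normedModType R}.

Lemma diff_near_eq (f g : V -> W) x : (\forall y \near x, f y = g y) ->
  differentiable f x -> differentiable g x /\ 'd g x = 'd f x :> (V -> W).
Proof.
move=> fg df.
have gx : g x = f x by rewrite (nbhs_singleton fg).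
have gE : g \o shift x = cst (g x) + 'd f x +o_ 0 id.
  apply/eqaddoP => e e0.
  have /eqaddoP/(_ e e0) := diff_locally df.
  apply: filter_app; near=> h.
  rewrite /= !fctE /= gx => H.
  suff <- : f (h + x) = g (h + x) by [].
  by near: h; move: fg; rewrite (near_shift 0) subr0.
have dgE : 'd g x = 'd f x :> (V -> W).
  by apply: diff_unique gE; apply: diff_continuous.
split=> //; apply/diff_locallyP; rewrite dgE; split=> //.
exact: diff_continuous.
Unshelve. all: by end_near. Qed.

End DiffNear.

Section DiffValues.
Context {R : realType} {V : normedModType R}.
Implicit Types (f g : V -> R) (x v : V).

Lemma diffDE f g x v : differentiable f x -> differentiable g x ->
  'd (fun y => f y + g y) x v = 'd f x v + 'd g x v.
Proof. by move=> df dg; exact: (congr1 (@^~ v) (diffD df dg)). Qed.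

Lemma diffME f g x v : differentiable f x -> differentiable g x ->
  'd (fun y => f y * g y) x v = f x * 'd g x v + g x * 'd f x v.
Proof. by move=> df dg; exact: (congr1 (@^~ v) (diffM df dg)). Qed.

Lemma diffVE f x v : differentiable f x -> f x != 0 ->
  'd (fun y => (f y)^-1) x v = - (f x) ^- 2 * 'd f x v.
Proof. by move=> df f0; exact: (congr1 (@^~ v) (diffV df f0)). Qed.

End DiffValues.

Lemma near_open (T : topologicalType) (U P : set T) x :
  open U -> (forall y, U y -> P y) -> U x -> \forall y \near x, P y.
Proof. by move=> oU UP Ux; apply: filterS UP _; apply: open_nbhs_nbhs. Qed.

Section Scalar.
Context {R : realType}.

(** The analogue of [Ck] for real values, where products and inverses make sense;
   [Ck_coordP] compares the two. *)
Fixpoint CkR d (k : nat) (U : set 'rV[R]_d) (f : 'rV[R]_d -> R) : Prop :=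
  if k is k'.+1 then
    (forall x, U x -> differentiable f x) /\
    (forall v, CkR k' U (fun x => 'd f x v))
  else forall x, U x -> {for x, continuous f}.

Definition smoothR d (U : set 'rV[R]_d) f := forall k, CkR k U f.

Section OneDomain.
Variable d : nat.
Implicit Types (U V : set 'rV[R]_d) (f g : 'rV[R]_d -> R).

Lemma CkRW k U f : CkR k.+1 U f -> CkR k U f.
Proof.
elim: k f => [|k IH] f [df ddf]; last by split=> // v; apply: IH.
by move=> x Ux; apply: differentiable_continuous; apply: df.
Qed.

(** Continuity and differentiability are tested point by point, so any subset [V]
   will do. *)
Lemma CkR_local k U f :
  (forall x, U x -> exists V, V x /\ CkR k V f) -> CkR k U f.
Proof.
elim: k f => [|k IH] f H /=.
  by move=> x /H [V [Vx /(_ x Vx)]].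
split=> [x /H [V [Vx [/(_ x Vx)]]] //|v].
by apply: IH => x /H [V [Vx [_ /(_ v)]]]; exists V.
Qed.

Lemma CkR_sub k U V f : V `<=` U -> CkR k U f -> CkR k V f.
Proof. by move=> VU Uf; apply: CkR_local => x /VU Ux; exists U. Qed.

Lemma CkR_eq k U f g : open U -> (forall x, U x -> f x = g x) ->
  CkR k U f -> CkR k U g.
Proof.
move=> oU; elim: k f g => [|k IH] f g fg /=.
  move=> cf x Ux; have nfg : \forall y \near x, f y = g y.
    exact: near_open Ux.
  rewrite /prop_for /continuous_at -(fg x Ux).
  exact: cvg_trans (near_eq_cvg nfg) (cf x Ux).
move=> [df ddf]; have H x : U x ->
    differentiable g x /\ 'd g x = 'd f x :> (_ -> _).
  move=> Ux; apply: diff_near_eq; last exact: df.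
  exact: near_open Ux.
split=> [x /H []//|v]; apply: IH (ddf v) => x /H [_ dE].
exact: esym (congr1 (@^~ v) dE).
Qed.

Lemma CkR_cst k U (a : R) : CkR k U (cst a).
Proof.
elim: k a => [|k IH] a /=; first by move=> x _; apply: cst_continuous.
split=> [x _|v]; first exact: differentiable_cst.
have -> : (fun x => 'd (cst a : 'rV[R]_d -> R) x v) = cst 0; last exact: IH.
by apply/funext => x; rewrite diff_cst.
Qed.

Lemma diff_coord (i : 'I_1) (j : 'I_d) (x : 'rV[R]_d) :
  'd (fun y : 'rV[R]_d => y i j) x = (fun y => y i j) :> (_ -> _).
Proof.
have lin_coord : linear (fun y : 'rV[R]_d => y i j) by move=> a u v; rewrite !mxE.
pose f : {linear 'rV[R]_d -> R} := HB.pack (fun y : 'rV[R]_d => y i j)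
  (GRing.isLinear.Build _ _ _ _ _ lin_coord).
by apply: (@diff_lin _ _ _ f); exact: coord_continuous.
Qed.

Lemma CkR_coord k U (i : 'I_1) (j : 'I_d) : CkR k U (fun y : 'rV[R]_d => y i j).
Proof.
case: k => [|k] /=; first by move=> x _; apply: coord_continuous.
split=> [x _|v]; first exact: differentiable_coord.
under eq_fun do rewrite diff_coord.
exact: CkR_cst.
Qed.

Lemma CkRD k U f g : open U -> CkR k U f -> CkR k U g ->
  CkR k U (fun x => f x + g x).
Proof.
move=> oU; elim: k f g => [|k IH] f g.
  by move=> cf cg x Ux; exact: (continuousD (cf x Ux) (cg x Ux)).
move=> [df ddf] [dg ddg]; split=> [x Ux|v].
  by apply: differentiableD; [apply: df|apply: dg].
apply: CkR_eq (IH _ _ (ddf v) (ddg v)) => // x Ux.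
exact: esym (diffDE v (df x Ux) (dg x Ux)).
Qed.

Lemma CkRM k U f g : open U -> CkR k U f -> CkR k U g ->
  CkR k U (fun x => f x * g x).
Proof.
move=> oU; elim: k f g => [|k IH] f g.
  by move=> cf cg x Ux; exact: (continuousM (cf x Ux) (cg x Ux)).
move=> df dg; have cf := CkRW df; have cg := CkRW dg.
case: df dg => [df ddf] [dg ddg]; split=> [x Ux|v].
  by apply: differentiableM; [apply: df|apply: dg].
apply: CkR_eq (CkRD oU (IH _ _ cf (ddg v)) (IH _ _ cg (ddf v))) => // x Ux.
exact: esym (diffME v (df x Ux) (dg x Ux)).
Qed.

Lemma CkR_sum k U I (r : seq I) (P : pred I) (F : I -> 'rV[R]_d -> R) :
  open U -> (forall i, P i -> CkR k U (F i)) ->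
  CkR k U (fun x => \sum_(i <- r | P i) F i x).
Proof.
move=> oU H; elim: r => [|i r IH].
  by apply: (CkR_eq (f := cst 0)) (CkR_cst k U _) => // x _; rewrite big_nil.
have [Pi|Pi] := boolP (P i); last first.
  by apply: CkR_eq IH => // x _; rewrite big_cons (negbTE Pi).
apply: CkR_eq (CkRD oU (H i Pi) IH) => // x _.
by rewrite big_cons Pi.
Qed.

Lemma CkRV k U f : open U -> (forall x, U x -> f x != 0) -> CkR k U f ->
  CkR k U (fun x => (f x)^-1).
Proof.
move=> oU; elim: k f => [|k IH] f f0.
  by move=> cf x Ux; exact: (continuousV (f0 x Ux) (cf x Ux)).
move=> df; have cf := CkRW df.
case: df => [df ddf]; split=> [x Ux|v].
  by apply: differentiableV; [apply: df|apply: f0].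
have Vf := IH f f0 cf.
apply: (CkR_eq (f := fun x => -1 * (f x)^-1 * (f x)^-1 * 'd f x v)) => //.
  move=> x Ux; apply: etrans (esym (diffVE v (df x Ux) (f0 x Ux))).
  by rewrite expr2 invfM mulN1r mulNr.
exact: (CkRM oU (CkRM oU (CkRM oU (CkR_cst k U (-1)) Vf) Vf) (ddf v)).
Qed.

End OneDomain.

Lemma diff_rowE d m (h : 'rV[R]_d -> 'rV[R]_m) x :
  (forall j, differentiable (fun y => h y 0 j) x) ->
  differentiable h x.
Proof.
move=> dh.
have -> : h = \sum_(j < m) (fun y => h y 0 j *: delta_mx 0 j).
  apply/funext => y; rewrite fct_sumE /=; exact: row_sum_delta.
apply: differentiable_sum => j; exact: differentiableZl.
Qed.

Lemma diff_rowP d m (h : 'rV[R]_d -> 'rV[R]_m) x v j :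
  differentiable h x ->
  differentiable (fun y => h y 0 j) x /\
  'd (fun y => h y 0 j) x v = 'd h x v 0 j.
Proof.
move=> dh; rewrite -[fun y => h y 0 j]/((fun z : 'rV_m => z 0 j) \o h).
split; first exact/differentiable_comp/differentiable_coord.
rewrite diff_comp //; last exact: differentiable_coord.
by rewrite diff_coord.
Qed.

Lemma Ck_coordP d m k (U : set 'rV[R]_d) (h : 'rV[R]_d -> 'rV[R]_m) : open U ->
  Ck k U h <-> forall j, CkR k U (fun x => h x 0 j).
Proof.
move=> oU; elim: k h => [|k IH] h /=; split.
- move=> ch j x Ux.
  apply: (@continuous_comp _ _ _ h (fun z : 'rV_m => z 0 j) x (ch x Ux)).
  exact: coord_continuous.
- move=> ch x Ux.
  move=> B /nbhs_ballP [e e0 eB].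
  suff : \forall y \near x, ball (h x) e (h y).
    by apply: filterS => y; exact: eB.
  have : forall j, \forall y \near x, ball (h x 0 j) e (h y 0 j).
    by move=> j; exact: (ch j x Ux _ (nbhsx_ballx _ _ e0)).
  move/filter_forall; apply: filterS => y hy; split=> // i j.
  by rewrite ord1.
- move=> [dh ddh] j; split=> [x Ux|v].
    exact: (diff_rowP 0 j (dh x Ux)).1.
  have := (IH _).1 (ddh v) j; apply: CkR_eq => // x Ux.
  by rewrite (diff_rowP v j (dh x Ux)).2.
- move=> dh; have dh' x : U x -> differentiable h x.
    by move=> Ux; apply: diff_rowE => j; have [/(_ x Ux)] := dh j.
  split=> // v; apply/IH => j; have [_ /(_ v)] := dh j.
  by apply: CkR_eq => // x Ux; rewrite (diff_rowP v j (dh' x Ux)).2.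
Qed.

(** By induction on [k]: the chain rule expresses the derivative of the composite as
   a sum of products of derivatives of the coordinates of [h] with composites of
   partial derivatives of [g]. *)
Lemma CkR_comp d m k (U : set 'rV[R]_d) (V : set 'rV[R]_m)
    (h : 'rV[R]_d -> 'rV[R]_m) (g : 'rV[R]_m -> R) :
  open U -> open V -> (forall x, U x -> V (h x)) ->
  (forall j, CkR k U (fun x => h x 0 j)) -> CkR k V g ->
  CkR k U (fun x => g (h x)).
Proof.
move=> oU oV UV; elim: k g => [|k IH] g.
  move=> ch cg x Ux; apply: (@continuous_comp _ _ _ h g).
    by have := (Ck_coordP 0 h oU).2 ch; apply.
  exact/cg/UV.
move=> dh [dg ddg]; have [dh' _] := (Ck_coordP k.+1 h oU).2 dh.
split=> [x Ux|v].
  by apply: (@differentiable_comp _ _ _ _ h g); [apply: dh'|apply/dg/UV].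
apply: (CkR_eq (f := fun x => \sum_(j < m)
  'd (fun y => h y 0 j) x v * 'd g (h x) (delta_mx 0 j))) => //.
  move=> x Ux; apply: etrans (esym (congr1 (@^~ v)
    (diff_comp (dh' x Ux) (dg _ (UV _ Ux))))).
  rewrite /= [in RHS](row_sum_delta ('d h x v)) linear_sum /=.
  apply: eq_bigr => j _.
  by rewrite linearZ /= (diff_rowP v j (dh' x Ux)).2.
apply: CkR_sum => // j _; apply: CkRM => //; first exact: (dh j).2.
apply: IH (ddg _) => i; exact/CkRW/dh.
Qed.

End Scalar.

(** * Smooth maps between Euclidean spaces *)

Section Vector.
Context {R : realType}.

Definition smoothrV d m (U : set 'rV[R]_d) (h : 'rV[R]_d -> 'rV[R]_m) : Prop :=
  forall j, smoothR U (fun x => h x 0 j).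

Lemma smooth_onP d m (U : set 'rV[R]_d) (h : 'rV[R]_d -> 'rV[R]_m) : open U ->
  smooth_on U h <-> smoothrV U h.
Proof.
move=> oU; split=> [H j k|H k]; first exact: (Ck_coordP k h oU).1 (H k) j.
by apply/Ck_coordP => // j; apply: H.
Qed.

Lemma smoothR_comp d m (U : set 'rV[R]_d) (V : set 'rV[R]_m) h g :
  open U -> open V -> (forall x, U x -> V (h x)) ->
  smoothrV U h -> smoothR V g -> smoothR U (fun x => g (h x)).
Proof.
by move=> oU oV UV sh sg k; apply: (@CkR_comp _ _ _ _ U V) => // j; apply: sh.
Qed.

Lemma open_preim d m (U : set 'rV[R]_d) (V : set 'rV[R]_m) h :
  open U -> open V -> smoothrV U h -> open (U `&` h @^-1` V).
Proof.
move=> oU oV sh; rewrite openE => x [Ux Vhx].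
have ch := ((Ck_coordP 0 h oU).2 (fun j => sh j 0%N)) x Ux.
have nU : nbhs x U by apply: open_nbhs_nbhs.
have nV : nbhs x (h @^-1` V) by apply: ch; apply: open_nbhs_nbhs.
exact: filterI nU nV.
Qed.

Lemma open_preimT d m (V : set 'rV[R]_m) (h : 'rV[R]_d -> 'rV[R]_m) :
  open V -> smoothrV setT h -> open (h @^-1` V).
Proof. by move=> oV sh; have := open_preim openT oV sh; rewrite setTI. Qed.

Lemma smoothR_sub d (U V : set 'rV[R]_d) f : V `<=` U -> smoothR U f -> smoothR V f.
Proof. by move=> VU H k; apply: CkR_sub (H k). Qed.

Lemma smoothrV_sub d m (U V : set 'rV[R]_d) (f : 'rV[R]_d -> 'rV[R]_m) :
  V `<=` U -> smoothrV U f -> smoothrV V f.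
Proof. by move=> VU H j; apply: smoothR_sub (H j). Qed.

Lemma smoothrV_id d (U : set 'rV[R]_d) : smoothrV U id.
Proof. by move=> j k; apply: CkR_coord. Qed.

Lemma smoothrV_cst d m (U : set 'rV[R]_d) (a : 'rV[R]_m) : smoothrV U (fun=> a).
Proof. by move=> j k; apply: CkR_cst. Qed.

Lemma smoothrV_row d m p (U : set 'rV[R]_d) (f : 'rV[R]_d -> 'rV[R]_m)
   (g : 'rV[R]_d -> 'rV[R]_p) : open U -> smoothrV U f -> smoothrV U g ->
  smoothrV U (fun x => row_mx (f x) (g x)).
Proof.
move=> oU sf sg j k; case: (split_ordP j) => i ->.
  by apply: CkR_eq (sf i k) => // x _; rewrite row_mxEl.
by apply: CkR_eq (sg i k) => // x _; rewrite row_mxEr.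
Qed.

Lemma smoothrV_lsub d m p (U : set 'rV[R]_d) (f : 'rV[R]_d -> 'rV[R]_(m + p)) :
  open U -> smoothrV U f -> smoothrV U (fun x => lsubmx (f x)).
Proof.
move=> oU sf j k; apply: CkR_eq (sf (lshift p j) k) => // x _.
by rewrite mxE.
Qed.

Lemma smoothrV_rsub d m p (U : set 'rV[R]_d) (f : 'rV[R]_d -> 'rV[R]_(m + p)) :
  open U -> smoothrV U f -> smoothrV U (fun x => rsubmx (f x)).
Proof.
move=> oU sf j k; apply: CkR_eq (sf (rshift m j) k) => // x _.
by rewrite mxE.
Qed.

Lemma smoothrVD d m (U : set 'rV[R]_d) (f g : 'rV[R]_d -> 'rV[R]_m) :
  open U -> smoothrV U f -> smoothrV U g -> smoothrV U (fun x => f x + g x).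
Proof.
move=> oU sf sg j k; apply: CkR_eq (CkRD oU (sf j k) (sg j k)) => // x _.
by rewrite mxE.
Qed.

Lemma smoothrV_mul d m p (U : set 'rV[R]_d) (f : 'rV[R]_d -> 'rV[R]_m)
    (P : 'M[R]_(m, p)) :
  open U -> smoothrV U f -> smoothrV U (fun x => f x *m P).
Proof.
move=> oU sf j k.
apply: (CkR_eq (f := fun x => \sum_i f x 0 i * P i j)) => //.
  by move=> x _; rewrite mxE.
by apply: CkR_sum => // i _; apply: CkRM => //; [exact: sf|exact: CkR_cst].
Qed.

Lemma smoothrVB d m (U : set 'rV[R]_d) (f g : 'rV[R]_d -> 'rV[R]_m) :
  open U -> smoothrV U f -> smoothrV U g -> smoothrV U (fun x => f x - g x).
Proof.
move=> oU sf sg; apply: smoothrVD => // j k.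
apply: (CkR_eq (f := fun x => -1 * g x 0 j)) => //.
  by move=> x _; rewrite mxE mulN1r.
by apply: CkRM => //; [exact: CkR_cst|exact: sg].
Qed.

End Vector.

(** * Germs in a chart *)

Section Germs.
Context {R : realType}.

Section OneChart.
Variables (T : Type) (c : chart R T).
Implicit Types (P Q : set T) (f g : T -> R) (x : T).

(** The point [x] has a neighbourhood in the domain of the chart [c] that is
   contained in [P]; points outside of this domain are ignored. *)
Definition near_in x P : Prop :=
  exists W, [/\ open W, W (c x) & forall y, cdom c y -> W (c y) -> P y].

Definition rsmooth_in f x : Prop :=
  exists W h, [/\ open W, W (c x), smoothR W h &
    forall y, cdom c y -> W (c y) -> f y = h (c y)].

Lemma near_inI x P Q : near_in x P -> near_in x Q -> near_in x (P `&` Q).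
Proof.
move=> [W [oW Wx WP]] [V [oV Vx VQ]]; exists (W `&` V).
by split=> [||y dy [Wy Vy]]; [exact: openI| |split; [exact: WP|exact: VQ]].
Qed.

Lemma near_inS x P Q : P `<=` Q -> near_in x P -> near_in x Q.
Proof. by move=> PQ [W [oW Wx WP]]; exists W; split=> // y ? ?; apply/PQ/WP. Qed.

Lemma near_inT x : near_in x setT.
Proof. by exists setT; split=> //; exact: openT. Qed.

Lemma rsmooth_in_eq x f g :
  near_in x [set y | f y = g y] -> rsmooth_in f x -> rsmooth_in g x.
Proof.
move=> [W [oW Wx fg]] [V [h [oV Vx sh fh]]]; exists (W `&` V), h; split=> //.
- exact: openI.
- exact: smoothR_sub sh.
- by move=> y dy [Wy Vy]; rewrite -fg // fh.
Qed.

Lemma rsmooth_in_cst a x : rsmooth_in (fun=> a) x.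
Proof.
exists setT, (fun=> a); split=> //; first exact: openT.
by move=> k; apply: CkR_cst.
Qed.

(** Finitely many functions are read in the chart on a common open set. *)
Lemma rsmooth_in_vec m (F : T -> 'rV[R]_m) x :
  cdom c x -> (forall j, rsmooth_in (fun y => F y 0 j) x) ->
  exists W H, [/\ open W, W (c x), smoothrV W H &
    forall y, cdom c y -> W (c y) -> F y = H (c y)].
Proof.
move=> dx sF.
have [W hW] := choice (fun j => sF j).
have [h Wh] := choice hW; move: {hW} Wh => Wh.
have oW1 : open [set w | forall j, W j w].
  rewrite openE => w Ww.
  have nW i : \forall v \near w, W i v.
    by apply: open_nbhs_nbhs; split=> //; have [] := Wh i.
  exact: filter_forall nW.
exists [set w | forall j, W j w], (fun w => \row_j h j w); split=> //.
- by move=> j; have [] := Wh j.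
- move=> j k; have [oW _ sh _] := Wh j.
  apply: (CkR_eq (f := h j)) => //; first by move=> w _; rewrite mxE.
  by apply: CkR_sub (sh k) => w; apply.
- move=> y dy Wy; apply/rowP => j; rewrite mxE.
  by have [_ _ _ /(_ y dy (Wy j))] := Wh j.
Qed.

Lemma rsmooth_in_comp m (F : T -> 'rV[R]_m) (V : set 'rV[R]_m)
    (g : 'rV[R]_m -> R) x :
  (forall j, rsmooth_in (fun y => F y 0 j) x) -> open V -> cdom c x -> V (F x) ->
  near_in x (F @^-1` V) /\ (smoothR V g -> rsmooth_in (fun y => g (F y)) x).
Proof.
move=> sF oV dx VFx; have [W [H [oW Wx sH FH]]] := rsmooth_in_vec dx sF.
have oW2 : open (W `&` H @^-1` V) by apply: open_preim.
have W2x : (W `&` H @^-1` V) (c x) by split=> //=; rewrite -FH.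
split=> [|sg].
  by exists (W `&` H @^-1` V); split=> // y dy [Wy /=]; rewrite -FH.
exists (W `&` H @^-1` V), (fun w => g (H w)); split=> //.
- have UV w : (W `&` H @^-1` V) w -> V (H w) by case.
  apply: (smoothR_comp (g := g) oW2 oV UV) => //.
  by apply: smoothrV_sub sH => w [].
- by move=> y dy [Wy _]; rewrite FH.
Qed.

Section Operations.
Variable x : T.
Hypothesis dx : cdom c x.

(* Sums and products are composites of a pair of functions with a smooth function
   of two variables. *)
Let row2 f g y : 'rV[R]_2 := \row_(i < 2) (if i == 0 then f y else g y).

Let row2P f g : rsmooth_in f x -> rsmooth_in g x ->
  forall j, rsmooth_in (fun y => row2 f g y 0 j) x.
Proof.
move=> sf sg j.
have E y : row2 f g y 0 j = if j == 0 then f y else g y by rewrite mxE.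
have [j0|jN0] := eqVneq j 0.
  by apply: rsmooth_in_eq sf; apply: near_inS (near_inT _) => y _ /=; rewrite E j0.
apply: rsmooth_in_eq sg.
by apply: near_inS (near_inT _) => y _ /=; rewrite E (negbTE jN0).
Qed.

Lemma rsmooth_inD f g : rsmooth_in f x -> rsmooth_in g x ->
  rsmooth_in (fun y => f y + g y) x.
Proof.
move=> sf sg; have [_ H] := rsmooth_in_comp (fun w : 'rV[R]_2 => w 0 0 + w 0 1)
  (row2P sf sg) openT dx I.
have {}H := H (fun k => CkRD openT (CkR_coord _ _ _ _) (CkR_coord _ _ _ _)).
by apply: rsmooth_in_eq H; apply: near_inS (near_inT _) => y _; rewrite /= !mxE.
Qed.

Lemma rsmooth_inM f g : rsmooth_in f x -> rsmooth_in g x ->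
  rsmooth_in (fun y => f y * g y) x.
Proof.
move=> sf sg; have [_ H] := rsmooth_in_comp (fun w : 'rV[R]_2 => w 0 0 * w 0 1)
  (row2P sf sg) openT dx I.
have {}H := H (fun k => CkRM openT (CkR_coord _ _ _ _) (CkR_coord _ _ _ _)).
by apply: rsmooth_in_eq H; apply: near_inS (near_inT _) => y _; rewrite /= !mxE.
Qed.

Lemma rsmooth_in_sum I (r : seq I) (P : pred I) (F : I -> T -> R) :
  (forall i, P i -> rsmooth_in (F i) x) ->
  rsmooth_in (fun y => \sum_(i <- r | P i) F i y) x.
Proof.
move=> H; elim: r => [|i r IH].
  apply: rsmooth_in_eq (rsmooth_in_cst 0 x).
  by apply: near_inS (near_inT _) => y _ /=; rewrite big_nil.
have [Pi|Pi] := boolP (P i); last first.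
  apply: rsmooth_in_eq IH.
  by apply: near_inS (near_inT _) => y _ /=; rewrite big_cons (negbTE Pi).
apply: rsmooth_in_eq (rsmooth_inD (H i Pi) IH).
by apply: near_inS (near_inT _) => y _ /=; rewrite big_cons Pi.
Qed.

End Operations.

End OneChart.

(** Only the change of charts from [c'] to [c] matters, and injectivity of [c'],
   which recovers a point from its image in the overlap of the domains. *)
Lemma near_in_change T (c c' : chart R T) x P :
  is_chart c' -> smooth_change c' c ->
  cdom c x -> cdom c' x -> near_in c x P -> near_in c' x P.
Proof.
move=> [injc' _] [oO [h [sh hc]]] dx d'x [W [oW Wx WP]].
have sh' := (smooth_onP h oO).1 sh.
exists (c' @` (cdom c' `&` cdom c) `&` h @^-1` W); split.
- exact: open_preim.
- by split; [exists x|rewrite /= -hc].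
- move=> y d'y [[z [d'z dz] zy] /= Wy].
  have zE : z = y by apply: injc'; rewrite ?inE.
  by rewrite -{}zE in Wy *; apply: WP => //; rewrite hc // zy.
Qed.

Lemma rsmooth_in_change T (c c' : chart R T) x f :
  is_chart c' -> smooth_change c' c ->
  cdom c x -> cdom c' x -> rsmooth_in c f x -> rsmooth_in c' f x.
Proof.
move=> ic' [oO [h [sh hc]]] dx d'x [W [g [oW Wx sg fg]]].
have sh' := (smooth_onP h oO).1 sh.
have n' : near_in c' x [set y | cdom c y].
  exists (c' @` (cdom c' `&` cdom c)); split=> //; first by exists x.
  move=> y d'y [z [d'z dz] zy]; suff <- : z = y by [].
  by apply: ic'.1; rewrite ?inE.
have sc j : rsmooth_in c' (fun y => c y 0 j) x.
  exists (c' @` (cdom c' `&` cdom c)), (fun w => h w 0 j); split=> //.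
    by exists x.
  move=> y d'y [z [d'z dz] zy]; rewrite -zy -hc //.
  by rewrite (_ : z = y) //; apply: ic'.1; rewrite ?inE.
have [nW sgc] := rsmooth_in_comp g sc oW d'x Wx.
apply: rsmooth_in_eq (sgc sg).
by apply: near_inS (near_inI n' nW) => y [dy Wy] /=; rewrite -fg.
Qed.

(** The change of charts has to be given by one function on the whole overlap: it is
   [c'] composed with a chosen inverse of [c], and it is smooth since it is so
   locally. *)
Lemma smooth_change_rsmooth T (c c' : chart R T) : is_chart c ->
  open (c @` (cdom c `&` cdom c')) ->
  (forall x, cdom c x -> cdom c' x ->
    forall j, rsmooth_in c (fun y => c' y 0 j) x) ->
  smooth_change c c'.
Proof.
move=> [injc oi] oO sf; split=> //.
pose h w := if pselect ((c @` (cdom c `&` cdom c')) w) is left p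
  then c' (sval (cid2 p)) else 0.
have hE x : cdom c x -> cdom c' x -> h (c x) = c' x.
  move=> dx d'x; rewrite /h; case: pselect => [p|[]]; last by exists x.
  case: cid2 => y /= [dy d'y] yx; congr (c' _).
  by apply: injc; rewrite ?inE.
exists h; split; last by move=> x dx d'x; rewrite hE.
apply/smooth_onP => // j k; apply: CkR_local => _ [x [dx d'x] <-].
have [W [g [oW Wx sg fg]]] := sf x dx d'x j.
exists (c @` (cdom c `&` cdom c') `&` W); split.
  by split=> //; exists x.
apply: (CkR_eq (f := g)); first exact: openI.
  by move=> _ [[y [dy d'y] <-] Wy]; rewrite hE // -fg.
by apply: CkR_sub (sg k) => w [].
Qed.

End Germs.

(** * Smooth functions on manifolds *)

Section Pre.
Context {R : realType}.
Implicit Types M N : charted R.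

(** What it takes to compute with smooth functions; the conditions on the topology
   of a manifold are treated separately. *)
Definition premanifold M : Prop :=
  [/\ forall c : chart R M, atlas c -> is_chart c,
      forall x : M, exists2 c, atlas c & cdom c x
    & forall c c' : chart R M, atlas c -> atlas c' -> compatible c c'].

Lemma smooth_premanifold M : smooth_manifold M -> premanifold M.
Proof. by case. Qed.

(** [P] is a neighbourhood of [x]. *)
Definition mnear M (x : M) (P : set M) : Prop :=
  exists c : chart R M, [/\ atlas c, cdom c x & near_in c x P].

(** One chart suffices, and then all admissible charts do, by [rsmooth_adm]. *)
Definition rsmooth M (f : M -> R) (x : M) : Prop :=
  exists c : chart R M, [/\ atlas c, cdom c x & rsmooth_in c f x].

Definition vsmooth M m (f : M -> 'rV[R]_m) (x : M) : Prop :=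
  forall j, rsmooth (fun y => f y 0 j) x.

Section One.
Variable M : charted R.
Hypothesis pM : premanifold M.
Implicit Types (x y : M) (P Q U : set M) (f g : M -> R) (c : chart R M).

Lemma atlas_adm c : atlas c -> admissible c.
Proof. by case: pM => ic _ cc ac; split=> [|c' ac']; [exact: ic|exact: cc]. Qed.

Lemma mnear_adm c x P : admissible c -> cdom c x -> mnear x P <-> near_in c x P.
Proof.
move=> [ic cc] dx; split=> [[c' [ac' d'x]]|].
  by apply: near_in_change => //; apply: (cc _ ac').1.
have [_ /(_ x) [c' ac' d'x] _] := pM.
move=> nP; exists c'; split=> //; apply: near_in_change nP => //.
  by have [H _ _] := pM; apply: H.
exact: (cc _ ac').2.
Qed.

Lemma rsmooth_adm c x f : admissible c -> cdom c x ->
  rsmooth f x <-> rsmooth_in c f x.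
Proof.
move=> [ic cc] dx; split=> [[c' [ac' d'x]]|].
  by apply: rsmooth_in_change => //; apply: (cc _ ac').1.
have [_ /(_ x) [c' ac' d'x] _] := pM.
move=> nP; exists c'; split=> //; apply: rsmooth_in_change nP => //.
  by have [H _ _] := pM; apply: H.
exact: (cc _ ac').2.
Qed.

Lemma exists_chart x : exists c, [/\ atlas c, admissible c & cdom c x].
Proof.
have [_ /(_ x) [c ac dx] _] := pM.
by exists c; split=> //; apply: atlas_adm.
Qed.

Lemma mnearS x P Q : P `<=` Q -> mnear x P -> mnear x Q.
Proof. by move=> PQ [c [ac dx nP]]; exists c; split=> //; apply: near_inS nP. Qed.

Lemma mnearT x : mnear x setT.
Proof.
by have [c [ac _ dx]] := exists_chart x; exists c; split=> //; apply: near_inT.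
Qed.

Lemma mnearI x P Q : mnear x P -> mnear x Q -> mnear x (P `&` Q).
Proof.
have [c [ac aac dx]] := exists_chart x.
move=> /(mnear_adm _ aac dx) nP /(mnear_adm _ aac dx) nQ.
exact/(mnear_adm _ aac dx)/near_inI.
Qed.

Lemma mopen_mnear U x : mopen U -> U x -> mnear x U.
Proof.
have [c [ac aac dx]] := exists_chart x.
move=> oU Ux; exists c; split=> //; exists (c @` (cdom c `&` U)); split.
- exact: oU.
- by exists x.
- move=> y dy [z [dz Uz] zy]; suff <- : z = y by [].
  by apply: aac.1.1; rewrite ?inE.
Qed.

Lemma adm_open c U : admissible c -> (forall x, U x -> mnear x U) ->
  open (c @` (cdom c `&` U)).
Proof.
move=> ac nU; rewrite openE => _ [x [dx Ux] <-].
have [W [oW Wx WU]] := (mnear_adm _ ac dx).1 (nU x Ux).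
apply: (@filterS _ _ _ (c @` cdom c `&` W)); last first.
  apply: open_nbhs_nbhs; split; last by split=> //; exists x.
  by apply: openI => //; have [[_]] := ac.
by move=> _ [[y dy <-] Wy]; exists y => //; split=> //; apply: WU.
Qed.

Lemma mopenP U : mopen U <-> forall x, U x -> mnear x U.
Proof.
split=> [oU x|nU c ac]; first exact: mopen_mnear.
by apply: adm_open => //; apply: atlas_adm.
Qed.

Lemma mopenI U V : mopen U -> mopen V -> mopen (U `&` V).
Proof.
by move=> /mopenP oU /mopenP oV; apply/mopenP => x [/oU nU /oV nV]; apply: mnearI.
Qed.

Lemma adm_dom c x : admissible c -> cdom c x -> mnear x (cdom c).
Proof.
by move=> ac dx; apply/(mnear_adm _ ac dx); exists setT; split=> //; exact: openT.
Qed.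

Lemma adm_mopen c : admissible c -> mopen (cdom c).
Proof. by move=> ac; apply/mopenP => x; apply: adm_dom. Qed.

Lemma adm_vsmooth c x : admissible c -> cdom c x -> vsmooth c x.
Proof.
move=> ac dx j; apply/(rsmooth_adm _ ac dx).
exists setT, (fun w => w 0 j); split=> //; first exact: openT.
by move=> k; apply: CkR_coord.
Qed.

Lemma rsmooth_eq x f g :
  mnear x [set y | f y = g y] -> rsmooth f x -> rsmooth g x.
Proof.
have [c [ac aac dx]] := exists_chart x.
move=> /(mnear_adm _ aac dx) fg /(rsmooth_adm _ aac dx) sf.
by apply/(rsmooth_adm _ aac dx); apply: rsmooth_in_eq sf.
Qed.

Lemma rsmooth_ext x f g : (forall y, f y = g y) -> rsmooth f x -> rsmooth g x.
Proof.
by move=> fg; apply: rsmooth_eq; apply: mnearS (mnearT x) => y _; apply: fg.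
Qed.

Lemma rsmooth_cst a x : rsmooth (fun=> a) x.
Proof.
have [c [ac aac dx]] := exists_chart x.
by exists c; split=> //; apply: rsmooth_in_cst.
Qed.

Lemma vsmooth_near m (F : M -> 'rV[R]_m) (V : set 'rV[R]_m) x :
  vsmooth F x -> open V -> V (F x) -> mnear x (F @^-1` V).
Proof.
have [c [ac aac dx]] := exists_chart x.
move=> sF oV Vx; apply/(mnear_adm _ aac dx).
apply: (rsmooth_in_comp (fun=> 0) _ oV dx Vx).1 => j.
exact/(rsmooth_adm _ aac dx)/sF.
Qed.

Lemma rsmooth_comp m (F : M -> 'rV[R]_m) (V : set 'rV[R]_m)
    (g : 'rV[R]_m -> R) x :
  vsmooth F x -> open V -> V (F x) -> smoothR V g -> rsmooth (fun y => g (F y)) x.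
Proof.
have [c [ac aac dx]] := exists_chart x.
move=> sF oV Vx sg; apply/(rsmooth_adm _ aac dx).
apply: (rsmooth_in_comp g _ oV dx Vx).2 sg => j.
exact/(rsmooth_adm _ aac dx)/sF.
Qed.

Lemma rsmooth_near f (V : set R) x :
  rsmooth f x -> open V -> V (f x) -> mnear x (f @^-1` V).
Proof.
move=> sf oV Vx.
pose F := fun y => \row_(_ < 1) f y.
have sF : vsmooth F x by move=> j; apply: rsmooth_ext sf => y; rewrite mxE.
have oV' : open [set w : 'rV[R]_1 | V (w 0 0)].
  by apply: open_comp oV => w _; apply: coord_continuous.
apply: mnearS (vsmooth_near sF oV' _) => [y /=|/=]; by rewrite mxE.
Qed.

Lemma rsmoothM x f g :
  rsmooth f x -> rsmooth g x -> rsmooth (fun y => f y * g y) x.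
Proof.
have [c [ac aac dx]] := exists_chart x.
move=> /(rsmooth_adm _ aac dx) sf /(rsmooth_adm _ aac dx) sg.
exact/(rsmooth_adm _ aac dx)/rsmooth_inM.
Qed.

Lemma rsmoothV x f : rsmooth f x -> f x != 0 -> rsmooth (fun y => (f y)^-1) x.
Proof.
move=> sf fx0.
have oV : open [set w : 'rV[R]_1 | w 0 0 != 0].
  apply: (@open_comp _ _ (fun w : 'rV[R]_1 => w 0 0) [set a | a != 0]).
    by move=> w _; apply: coord_continuous.
  exact: open_neq.
have sF : vsmooth (fun y => \row_(_ < 1) f y) x.
  by move=> j; apply: rsmooth_ext sf => y; rewrite mxE.
have sV : smoothR [set w : 'rV[R]_1 | w 0 0 != 0] (fun w => (w 0 0)^-1).
  by move=> k; apply: CkRV => //; apply: CkR_coord.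
have Vx : (fun w : 'rV[R]_1 => w 0 0 != 0) (\row_(_ < 1) f x) by rewrite mxE.
have := rsmooth_comp sF oV Vx sV; apply: rsmooth_ext => y; by rewrite mxE.
Qed.

Lemma rsmooth_sum x I (r : seq I) (P : pred I) (F : I -> M -> R) :
  (forall i, P i -> rsmooth (F i) x) ->
  rsmooth (fun y => \sum_(i <- r | P i) F i y) x.
Proof.
have [c [ac aac dx]] := exists_chart x.
move=> sF; apply/(rsmooth_adm _ aac dx)/rsmooth_in_sum => // i Pi.
exact/(rsmooth_adm _ aac dx)/sF.
Qed.

Lemma rsmooth_prod x I (r : seq I) (P : pred I) (F : I -> M -> R) :
  (forall i, P i -> rsmooth (F i) x) ->
  rsmooth (fun y => \prod_(i <- r | P i) F i y) x.
Proof.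
move=> H; elim: r => [|i r IH].
  by apply: rsmooth_ext (rsmooth_cst 1 x) => y; rewrite big_nil.
have [Pi|Pi] := boolP (P i); last first.
  by apply: rsmooth_ext IH => y; rewrite big_cons (negbTE Pi).
by apply: rsmooth_ext (rsmoothM (H i Pi) IH) => y; rewrite big_cons Pi.
Qed.

Lemma rsmooth_det x n (F : M -> 'M[R]_n) :
  (forall i j, rsmooth (fun y => F y i j) x) -> rsmooth (fun y => \det (F y)) x.
Proof.
move=> sF; apply: rsmooth_sum => s _; apply: rsmoothM; first exact: rsmooth_cst.
by apply: rsmooth_prod => i _; apply: sF.
Qed.

(** Cramer's rule. *)
Lemma rsmooth_invmx x n (F : M -> 'M[R]_n) :
  (forall i j, rsmooth (fun y => F y i j) x) -> F x \in unitmx ->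
  mnear x [set y | F y \in unitmx] /\
  forall i j, rsmooth (fun y => invmx (F y) i j) x.
Proof.
move=> sF; rewrite unitmxE unitfE => dx.
have nU : mnear x [set y | F y \in unitmx].
  have := rsmooth_near (rsmooth_det sF) (@open_neq R 0) dx.
  by apply: mnearS => y /=; rewrite unitmxE unitfE.
split=> // i j.
apply: (@rsmooth_eq _ (fun y => (\det (F y))^-1 * \adj (F y) i j)).
  by apply: mnearS nU => y /= Fy; rewrite /invmx Fy [in RHS]mxE.
apply: rsmoothM; first exact/rsmoothV/dx/rsmooth_det.
apply: (@rsmooth_ext _ (fun y => (-1) ^+ (j + i) * \det (row' j (col' i (F y))))).
  by move=> y; rewrite /adjugate mxE.
apply: rsmoothM; first exact: rsmooth_cst.
apply: rsmooth_det => k l; apply: rsmooth_ext (sF (lift j k) (lift i l)) => y.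
by rewrite !mxE.
Qed.

End One.
End Pre.

(** * Smooth maps between manifolds *)

Section SmoothMaps.
Context {R : realType}.
Implicit Types M N P : charted R.

Section Pullback.
Variables (M N : charted R) (F : M -> N) (x : M).
Hypotheses (pN : premanifold N) (sF : smooth_at F x).

Lemma smooth_at_near (Q : set N) : mnear (F x) Q -> mnear x (F @^-1` Q).
Proof.
have [c [c' [W [h [[ac ac'] [dx Wx] [oW Wc] Fh sh]]]]] := sF.
have [d'x _] := Fh x dx Wx.
move=> /(mnear_adm pN _ (atlas_adm pN ac') d'x) [V [oV Vx VQ]].
exists c; split=> //; exists (W `&` h @^-1` V); split.
- exact/open_preim/(smooth_onP h oW).1.
- by split=> //=; rewrite -(Fh x dx Wx).2.
- move=> y dy [Wy /= Vy]; have [d'y Fy] := Fh y dy Wy.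
  by apply: VQ => //; rewrite Fy.
Qed.

Lemma smooth_at_rsmooth (g : N -> R) :
  rsmooth g (F x) -> rsmooth (fun y => g (F y)) x.
Proof.
have [c [c' [W [h [[ac ac'] [dx Wx] [oW Wc] Fh sh]]]]] := sF.
have [d'x _] := Fh x dx Wx.
move=> /(rsmooth_adm pN _ (atlas_adm pN ac') d'x) [V [k [oV Vx sk gk]]].
have sh' := (smooth_onP h oW).1 sh.
have oWV := open_preim oW oV sh'.
exists c; split=> //; exists (W `&` h @^-1` V), (fun w => k (h w)); split=> //.
- by split=> //=; rewrite -(Fh x dx Wx).2.
- have WV w : (W `&` h @^-1` V) w -> V (h w) by case.
  apply: (smoothR_comp (g := k) oWV oV WV) => //.
  by apply: smoothrV_sub sh' => w [].
- move=> y dy [Wy /= Vy]; have [d'y Fy] := Fh y dy Wy.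
  by rewrite gk // Fy.
Qed.

Lemma smooth_at_vsmooth m (g : N -> 'rV[R]_m) :
  vsmooth g (F x) -> vsmooth (fun y => g (F y)) x.
Proof. by move=> sg j; apply: (smooth_at_rsmooth (sg j)). Qed.

End Pullback.

Lemma smooth_at_atlas M N (F : M -> N) (x : M) (b : chart R N) :
  premanifold M -> atlas b -> mnear x (F @^-1` cdom b) ->
  vsmooth (fun y => b (F y)) x -> smooth_at F x.
Proof.
move=> pM ab nF sF; have [a [aa ada dx]] := exists_chart pM x.
have [W0 [oW0 W0x nF0]] := (mnear_adm pM _ ada dx).1 nF.
have [V [H [oV Vx sH FH]]] :=
  rsmooth_in_vec dx (fun j => (rsmooth_adm pM _ ada dx).1 (sF j)).
have [[ia oa] _] := ada.
have oW : open (V `&` W0 `&` a @` cdom a) by do 2?apply: openI.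
exists a, b, (V `&` W0 `&` a @` cdom a), H; split.
- by [].
- by split=> //; split=> //; exists x.
- by split=> // w; case.
- by move=> y dy [[Vy W0y] _]; split; [apply: nF0|apply: FH].
- by apply/smooth_onP => //; apply: smoothrV_sub sH => w [[]].
Qed.

Lemma smooth_at_adm M N (F : M -> N) (x : M) (c : chart R N) :
  premanifold M -> premanifold N -> admissible c -> cdom c (F x) ->
  smooth_at F x <-> mnear x (F @^-1` cdom c) /\ vsmooth (fun y => c (F y)) x.
Proof.
move=> pM pN ac dFx; split=> [sF|[nF sc]].
  split; first by apply: smooth_at_near => //; apply: adm_dom.
  by apply: (smooth_at_vsmooth pN sF); apply: adm_vsmooth.
have [b [ab adb dFx']] := exists_chart pN (F x).
have sbc j := (rsmooth_adm pN _ ac dFx).1 (adm_vsmooth pN adb dFx' j).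
have [V [H [oV Vx sH bH]]] := rsmooth_in_vec dFx sbc.
have nV := vsmooth_near pM sc oV Vx.
have [W1 [oW1 W1x nb]] := (mnear_adm pN _ ac dFx).1 (adm_dom pN adb dFx').
have nW1 := vsmooth_near pM sc oW1 W1x.
apply: (smooth_at_atlas pM ab).
  by apply: mnearS (mnearI pM nF nW1) => y [dy Wy]; apply: nb.
move=> j; apply: (rsmooth_eq pM (f := fun y => H (c (F y)) 0 j)).
  by apply: mnearS (mnearI pM nF nV) => y [dy Vy] /=; rewrite bH.
exact: (rsmooth_comp pM (g := fun w => H w 0 j) sc oV Vx (sH j)).
Qed.

Lemma smooth_at_comp M N P (F : M -> N) (G : N -> P) (x : M) :
  premanifold M -> premanifold N -> premanifold P ->
  smooth_at F x -> smooth_at G (F x) -> smooth_at (fun y => G (F y)) x.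
Proof.
move=> pM pN pP sF sG; have [c [ac adc dx]] := exists_chart pP (G (F x)).
have [nG sc] := (smooth_at_adm pN pP adc dx).1 sG.
apply: (smooth_at_atlas pM ac).
  exact: (smooth_at_near pN sF nG).
exact: (smooth_at_vsmooth pN sF sc).
Qed.

Lemma smooth_at_cst M N (a : N) (x : M) : premanifold M -> premanifold N ->
  smooth_at (fun _ : M => a) x.
Proof.
move=> pM pN; have [c [ac adc da]] := exists_chart pN a.
apply: (smooth_at_atlas pM ac).
  by apply: mnearS (mnearT pM x) => y _.
by move=> j; apply: rsmooth_cst.
Qed.

Lemma smooth_at_id M (x : M) : premanifold M -> smooth_at (fun y : M => y) x.
Proof.
move=> pM; have [c [ac adc da]] := exists_chart pM x.
by apply: (smooth_at_atlas pM ac); [apply: adm_dom|apply: adm_vsmooth].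
Qed.

(** ** Euclidean spaces *)

Lemma euclidean_pre r : premanifold (euclidean r : charted R).
Proof.
have E : (fun y : 'rV[R]_r => y) @` setT = setT.
  by apply/seteqP; split=> // y _; exists y.
have cc : smooth_change (Chart setT (@id 'rV[R]_r)) (Chart setT (@id 'rV[R]_r)).
  split; first by rewrite /= setIT E; exact: openT.
  exists id; split=> //; rewrite /= setIT E; apply/smooth_onP; first exact: openT.
  exact: smoothrV_id.
split.
- move=> c /= ->; split=> /=; first by move=> x y _ _ /=.
  by rewrite E; exact: openT.
- by move=> x; exists (Chart setT (@id 'rV[R]_r)).
- by move=> c c' /= -> ->; split.
Qed.

Lemma euclidean_vsmooth M r (F : M -> euclidean r) (x : M) : premanifold M ->
  smooth_at F x <-> vsmooth (F : M -> 'rV[R]_r) x.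
Proof.
move=> pM; have pE := euclidean_pre r.
have ac : admissible (Chart setT (@id 'rV[R]_r) : chart R (euclidean r)).
  by apply: (atlas_adm pE).
split=> [sF|sF]; first exact: ((smooth_at_adm pM pE ac I).1 sF).2.
apply/(smooth_at_adm pM pE ac I); split=> //.
by apply: mnearS (mnearT pM x) => y _.
Qed.

(** ** Products *)
Section Product.
Variables M N : charted R.
Hypotheses (pM : premanifold M) (pN : premanifold N).
Implicit Types (a : chart R M) (b : chart R N).

Definition prod_chart (a : chart R M) (b : chart R N) : chart R (product M N) :=
  Chart (cdom a `*` cdom b) (fun p => row_mx (a p.1) (b p.2)).

Lemma prod_chart_image a b (A : set M) (B : set N) :
  prod_chart a b @` (A `*` B) = lsubmx @^-1` (a @` A) `&` rsubmx @^-1` (b @` B).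
Proof.
apply/seteqP; split=> w /=.
  move=> [[p q] /= [Ap Bq] <-]; rewrite row_mxKl row_mxKr.
  by split; [exists p|exists q].
move=> [[p Ap pw] [q Bq qw]]; exists (p, q) => //=.
by rewrite pw qw hsubmxK.
Qed.

Lemma prod_chart_open a b (A : set M) (B : set N) :
  open (a @` A) -> open (b @` B) -> open (prod_chart a b @` (A `*` B)).
Proof.
move=> oA oB; rewrite prod_chart_image; apply: openI; apply: open_preimT => //.
  exact/smoothrV_lsub/smoothrV_id/openT.
exact/smoothrV_rsub/smoothrV_id/openT.
Qed.

Lemma prod_chart_rsmooth_fst a b f (p : product M N) :
  rsmooth_in a f p.1 -> rsmooth_in (prod_chart a b) (fun p => f p.1) p.
Proof.
move=> [W [h [oW Wx sh fh]]].
have sl : smoothrV setT (lsubmx : 'rV[R]_(cdim a + cdim b) -> _).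
  exact/smoothrV_lsub/smoothrV_id/openT.
have oW' := open_preimT oW sl.
exists (lsubmx @^-1` W), (fun w => h (lsubmx w)); split=> //.
- by rewrite /= row_mxKl.
- apply: (smoothR_comp oW' oW _ _ sh) => //; exact: smoothrV_sub sl.
- by move=> q [dq _] /=; rewrite row_mxKl => Wq; apply: fh.
Qed.

Lemma prod_chart_rsmooth_snd a b f (p : product M N) :
  rsmooth_in b f p.2 -> rsmooth_in (prod_chart a b) (fun p => f p.2) p.
Proof.
move=> [W [h [oW Wx sh fh]]].
have sl : smoothrV setT (rsubmx : 'rV[R]_(cdim a + cdim b) -> _).
  exact/smoothrV_rsub/smoothrV_id/openT.
have oW' := open_preimT oW sl.
exists (rsubmx @^-1` W), (fun w => h (rsubmx w)); split=> //.
- by rewrite /= row_mxKr.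
- apply: (smoothR_comp oW' oW _ _ sh) => //; exact: smoothrV_sub sl.
- by move=> q [_ dq] /=; rewrite row_mxKr => Wq; apply: fh.
Qed.

Lemma prod_chart_change a b a' b' : atlas a -> atlas b -> atlas a' -> atlas b' ->
  is_chart (prod_chart a b) -> smooth_change (prod_chart a b) (prod_chart a' b').
Proof.
move=> aa ab aa' ab' ic; apply: smooth_change_rsmooth => //=.
  rewrite -setXI; apply: prod_chart_open.
    by have [_ _ /(_ a a' aa aa') [[]]] := pM.
  by have [_ _ /(_ b b' ab ab') [[]]] := pN.
move=> p [da db] [da' db'] j; case: (split_ordP j) => i ->.
  apply: (@rsmooth_in_eq _ _ _ _ (fun q : product M N => a' q.1 0 i)).
    by apply: near_inS (near_inT _ _) => q _ /=; rewrite row_mxEl.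
  apply: (@prod_chart_rsmooth_fst a b (fun q => a' q 0 i)).
  apply/(rsmooth_adm pM) => //; first exact: (atlas_adm pM).
  exact/(adm_vsmooth pM)/da'/(atlas_adm pM).
apply: (@rsmooth_in_eq _ _ _ _ (fun q : product M N => b' q.2 0 i)).
  by apply: near_inS (near_inT _ _) => q _ /=; rewrite row_mxEr.
apply: (@prod_chart_rsmooth_snd a b (fun q => b' q 0 i)).
apply/(rsmooth_adm pN) => //; first exact: (atlas_adm pN).
exact/(adm_vsmooth pN)/db'/(atlas_adm pN).
Qed.

Lemma prod_chart_is_chart a b : atlas a -> atlas b -> is_chart (prod_chart a b).
Proof.
move=> aa ab; have [[ia oa] _] := atlas_adm pM aa.
have [[ib ob] _] := atlas_adm pN ab.
split; last exact: prod_chart_open.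
move=> [p q] [p' q']; rewrite !inE /= => -[da db] [da' db'] /eq_row_mx [pp qq].
by congr pair; [apply: ia|apply: ib]; rewrite ?inE.
Qed.

Lemma product_pre : premanifold (product M N).
Proof.
split.
- by move=> _ [a [b [aa ab ->]]]; apply: prod_chart_is_chart.
- move=> [p q]; have [a [aa _ dp]] := exists_chart pM p.
  have [b [ab _ dq]] := exists_chart pN q.
  by exists (prod_chart a b) => //; exists a, b.
- move=> _ _ [a [b [aa ab ->]]] [a' [b' [aa' ab' ->]]].
  by split; apply: prod_chart_change => //; apply: prod_chart_is_chart.
Qed.

Lemma prod_chart_adm a b : atlas a -> atlas b -> admissible (prod_chart a b).
Proof. by move=> aa ab; apply: (atlas_adm product_pre); exists a, b. Qed.

Lemma smooth_fst (p : product M N) : smooth_at (fun p : product M N => p.1 : M) p.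
Proof.
have [a [aa ada dp]] := exists_chart pM p.1.
have [b [ab adb dq]] := exists_chart pN p.2.
apply: (smooth_at_atlas product_pre aa).
  exists (prod_chart a b); split=> //; first by exists a, b.
  by exists setT; split=> // [|q []]; first exact: openT.
move=> j; exists (prod_chart a b); split=> //; first by exists a, b.
apply: (@prod_chart_rsmooth_fst a b (fun q => a q 0 j)).
exact/(rsmooth_adm pM)/(adm_vsmooth pM).
Qed.

Lemma smooth_snd (p : product M N) : smooth_at (fun p : product M N => p.2 : N) p.
Proof.
have [a [aa ada dp]] := exists_chart pM p.1.
have [b [ab adb dq]] := exists_chart pN p.2.
apply: (smooth_at_atlas product_pre ab).
  exists (prod_chart a b); split=> //; first by exists a, b.
  by exists setT; split=> // [|q []]; first exact: openT.
move=> j; exists (prod_chart a b); split=> //; first by exists a, b.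
apply: (@prod_chart_rsmooth_snd a b (fun q => b q 0 j)).
exact/(rsmooth_adm pN)/(adm_vsmooth pN).
Qed.

Lemma smooth_pair P (F : P -> M) (G : P -> N) (x : P) : premanifold P ->
  smooth_at F x -> smooth_at G x ->
  smooth_at (fun y => (F y, G y) : product M N) x.
Proof.
move=> pP sF sG.
have [a [aa ada dp]] := exists_chart pM (F x).
have [b [ab adb dq]] := exists_chart pN (G x).
have [nF sa] := (smooth_at_adm pP pM ada dp).1 sF.
have [nG sb] := (smooth_at_adm pP pN adb dq).1 sG.
apply: (@smooth_at_atlas P (product M N) _ _ (prod_chart a b) pP).
- by exists a, b.
- exact: mnearI.
- move=> j; case: (split_ordP j) => i ->.
    by apply: rsmooth_ext (sa i) => // y; rewrite /= row_mxEl.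
  by apply: rsmooth_ext (sb i) => // y; rewrite /= row_mxEr.
Qed.

End Product.

(** ** Change of coordinates *)

(** New admissible charts are obtained from [a] by a global change of coordinates
   [t] and restriction to an open set. *)
Lemma adm_transport M (a : chart R M) m (D : set M)
    (t : 'rV[R]_(cdim a) -> 'rV[R]_m) (t' : 'rV[R]_m -> 'rV[R]_(cdim a)) :
  premanifold M -> admissible a -> smoothrV setT t -> smoothrV setT t' ->
  cancel t t' -> cancel t' t -> mopen D -> D `<=` cdom a ->
  admissible (Chart D (fun p => t (a p))).
Proof.
move=> pM ada st st' tK t'K oD Da.
have imE (A : set M) : (fun p => t (a p)) @` A = t' @^-1` (a @` A).
  apply/seteqP; split=> w /=; first by move=> [p Ap <-]; rewrite tK; exists p.
  by move=> [p Ap pw]; exists p => //; rewrite pw t'K.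
have oim (U : set M) : mopen U -> open ((fun p => t (a p)) @` (D `&` U)).
  move=> oU; rewrite imE; apply: open_preimT => //.
  have -> : D `&` U = cdom a `&` (D `&` U) by rewrite setIA (setIidr Da).
  by apply: (adm_open pM) => // x; apply: mopen_mnear => //; apply: (mopenI pM).
have ic : is_chart (Chart D (fun p => t (a p))).
  split=> /=; last first.
    rewrite -[D]setIT; apply: oim; apply/(mopenP pM) => x _; exact: mnearT.
  move=> p q; rewrite !inE => Dp Dq /(congr1 t'); rewrite !tK.
  by apply: ada.1.1; rewrite inE; apply: Da.
split=> // c' ac'; have adc' := atlas_adm pM ac'.
split; apply: smooth_change_rsmooth => //=.
- exact/oim/(adm_mopen pM).
- move=> x Dx d'x j.
  have [W [h [oW Wx sh fh]]] :=
    (rsmooth_adm pM _ ada (Da x Dx)).1 (adm_vsmooth pM adc' d'x j).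
  exists (t' @^-1` W), (fun w => h (t' w)).
  have oW' := open_preimT oW st'.
  split=> //=; first by rewrite tK.
    by apply: (smoothR_comp oW' oW _ _ sh) => //; apply: smoothrV_sub st'.
  by move=> y Dy; rewrite tK; apply: fh; apply: Da.
- exact: adc'.1.
- by apply: (adm_open pM) => // x; apply: mopen_mnear.
- move=> x d'x Dx j; apply/(rsmooth_adm pM) => //.
  apply: (rsmooth_comp pM (V := setT) (g := fun w => t w 0 j)) => //.
    exact/(adm_vsmooth pM)/Da.
  exact: openT.
Qed.

(** ** Embedded submanifolds *)
Section Induced.
Variables (M : charted R) (T : Type) (i : T -> M).
Hypotheses (pM : premanifold M) (inj_i : injective i).
Hypothesis sub_i : submanifold (range i).

Lemma slice_at t : exists k l D (phi : M -> 'rV[R]_(k + l)),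
  D (i t) /\ slice_chart (range i) D phi.
Proof. by apply: sub_i; exists t. Qed.

Section SliceChart.
Variables (k l : nat) (D : set M) (phi : M -> 'rV[R]_(k + l)).
Hypothesis sc : slice_chart (range i) D phi.

Definition induced_chart : chart R (induced i) :=
  Chart (i @^-1` D) (fun t => lsubmx (phi (i t))).

Lemma induced_chart_atlas : atlas induced_chart.
Proof. by exists k, l, D, phi. Qed.

Lemma induced_chartK t : D (i t) -> row_mx (lsubmx (phi (i t))) 0 = phi (i t).
Proof.
move=> Dt; have := (sc.2 _ Dt).1 => /(_ (ex_intro2 _ _ t I erefl)) <-.
exact: hsubmxK.
Qed.

Let row0 := fun u : 'rV[R]_k => row_mx u (0 : 'rV[R]_l).

Let row0_smooth : smoothrV setT row0.
Proof.
by apply: (smoothrV_row openT); [exact: smoothrV_id|exact: smoothrV_cst].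
Qed.

(** The image of the chart is a section of the image of [phi] by the slice, so it is
   open. *)
Lemma induced_chart_image (U : set M) :
  induced_chart @` (i @^-1` D `&` i @^-1` U) = row0 @^-1` (phi @` (D `&` U)).
Proof.
apply/seteqP; split=> u /=.
  by move=> [t [Dt Ut] <-]; exists (i t) => //; rewrite /row0 induced_chartK.
move=> [p [Dp Up] pu].
have /(sc.2 p Dp).2 [t _ tp] : rsubmx (phi p) = 0 by rewrite pu row_mxKr.
by exists t; rewrite ?tp // pu row_mxKl.
Qed.

Lemma induced_chart_open (U : set M) : mopen U ->
  open (induced_chart @` (i @^-1` D `&` i @^-1` U)).
Proof.
move=> oU; rewrite induced_chart_image; apply: open_preimT row0_smooth.
by apply: (adm_open pM sc.1) => x; apply: mopen_mnear.
Qed.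

Lemma induced_chart_is_chart : is_chart induced_chart.
Proof.
split=> [t u|].
  rewrite !inE /= => Dt Du E; apply: inj_i; apply: sc.1.1.1; rewrite ?inE //=.
  by rewrite -(induced_chartK Dt) -(induced_chartK Du) E.
rewrite (_ : cdom induced_chart = i @^-1` D `&` i @^-1` setT); last first.
  by rewrite setIT.
by apply: induced_chart_open; apply/(mopenP pM) => x _; exact: mnearT.
Qed.

Lemma induced_chart_rsmooth g t : D (i t) -> rsmooth_in (Chart D phi) g (i t) ->
  rsmooth_in induced_chart (fun u => g (i u)) t.
Proof.
move=> Dt [W [h [oW Wx sh fh]]].
have oW' := open_preimT oW row0_smooth.
exists (row0 @^-1` W), (fun u => h (row0 u)); split=> //.
- by rewrite /= /row0 induced_chartK.
- by apply: (smoothR_comp oW' oW _ _ sh) => //; apply: smoothrV_sub row0_smooth.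
- by move=> u Du /=; rewrite /row0 induced_chartK // => Wu; apply: fh.
Qed.

Lemma induced_chart_near Q t : D (i t) -> near_in (Chart D phi) (i t) Q ->
  near_in induced_chart t (i @^-1` Q).
Proof.
move=> Dt [W [oW Wx WQ]]; exists (row0 @^-1` W); split.
- exact: open_preimT.
- by rewrite /= /row0 induced_chartK.
- by move=> u Du /=; rewrite /row0 induced_chartK // => Wu; apply: WQ.
Qed.

End SliceChart.

Lemma induced_pre : premanifold (induced i).
Proof.
split.
- by move=> _ [k [l [D [phi [sc ->]]]]]; apply: induced_chart_is_chart.
- move=> t; have [k [l [D [phi [Dt sc]]]]] := slice_at t.
  by exists (induced_chart D phi) => //; apply: induced_chart_atlas.
- have cc : forall c c' : chart R (induced i), atlas c -> atlas c' ->
      smooth_change c c'.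
    move=> _ _ [k [l [D [phi [sc ->]]]]] [k' [l' [D' [phi' [sc' ->]]]]].
    apply: smooth_change_rsmooth; first exact: induced_chart_is_chart.
      by apply: (induced_chart_open sc); apply: (adm_mopen pM sc'.1).
    move=> t /= Dt D't j.
    apply: (@induced_chart_rsmooth _ _ _ _ sc (fun p => lsubmx (phi' p) 0 j)) => //.
    apply/(rsmooth_adm pM) => //; first exact: sc.1.
    apply: rsmooth_ext (adm_vsmooth pM sc'.1 (x := i t) D't (lshift l' j)) => //.
    by move=> p; rewrite mxE.
  by move=> c c' ac ac'; split; apply: cc.
Qed.

Lemma induced_rsmooth (t : induced i) g :
  rsmooth g (i t) -> rsmooth (fun u : induced i => g (i u)) t.
Proof.
move=> sg; have [k [l [D [phi [Dt sc]]]]] := slice_at t.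
exists (induced_chart D phi); split=> //; first exact: induced_chart_atlas.
by apply: induced_chart_rsmooth => //; apply/(rsmooth_adm pM) => //; exact: sc.1.
Qed.

Lemma induced_near (t : induced i) Q : mnear (i t) Q -> mnear t (i @^-1` Q).
Proof.
move=> sg; have [k [l [D [phi [Dt sc]]]]] := slice_at t.
exists (induced_chart D phi); split=> //; first exact: induced_chart_atlas.
by apply: induced_chart_near => //; apply/(mnear_adm pM) => //; exact: sc.1.
Qed.

Lemma smooth_induced_map (t : induced i) : smooth_at (i : induced i -> M) t.
Proof.
have [c [ac adc dx]] := exists_chart pM (i t).
apply: (smooth_at_atlas induced_pre ac).
  exact/induced_near/(adm_dom pM).
move=> j; apply: (induced_rsmooth (g := fun p => c p 0 j)).
exact: (adm_vsmooth pM).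
Qed.

(** The coordinates of [F] in a chart of the submanifold are among those of
   [i \o F] in the straightening chart. *)
Lemma smooth_into_induced P (F : P -> induced i) (x : P) : premanifold P ->
  smooth_at (fun y => i (F y)) x -> smooth_at F x.
Proof.
move=> pP sF.
have [k [l [D [phi [Dt sc]]]]] := slice_at (F x).
have [nF sphi] := (smooth_at_adm pP pM sc.1 Dt).1 sF.
apply: (smooth_at_atlas (b := induced_chart D phi) pP) => //.
  exact: induced_chart_atlas.
move=> j; apply: rsmooth_ext (sphi (lshift l j)) => // y.
by rewrite mxE.
Qed.

Lemma induced_hausdorff : mhausdorff M -> mhausdorff (induced i).
Proof.
move=> hM t u tu; have [|U [V [oU oV Ut Vu UV]]] := hM (i t) (i u).
  by move/inj_i.
have oi (Q : set M) : mopen Q -> mopen (i @^-1` Q : set (induced i)).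
  move=> oQ; apply/(mopenP induced_pre) => x Qx.
  exact/induced_near/mopen_mnear.
exists (i @^-1` U), (i @^-1` V); split=> //; [exact: oi|exact: oi|].
by rewrite -preimage_setI UV preimage_set0.
Qed.

(** An open set of the submanifold is, near a point, the trace of an open set of [M]:
   in a straightening chart, its preimage under the projection to the slice. *)
Lemma induced_second_countable :
  msecond_countable M -> msecond_countable (induced i).
Proof.
move=> [B [oB bB]]; exists (fun n => i @^-1` (B n)); split=> [n|U t oU Ut].
  apply/(mopenP induced_pre) => x Qx.
  exact/induced_near/mopen_mnear.
have [k [l [D [phi [Dt sc]]]]] := slice_at t.
have := mopen_mnear induced_pre oU Ut.
have adi := atlas_adm induced_pre (induced_chart_atlas sc).
move=> /(mnear_adm induced_pre _ adi Dt) [W [oW Wt WU]].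
pose U' := D `&` (fun p => lsubmx (phi p)) @^-1` W.
have oU' : mopen U'.
  apply/(mopenP pM) => p [Dp Wp]; apply: (mnearI pM).
    exact: (adm_dom pM sc.1 Dp).
  apply: (vsmooth_near pM _ oW Wp) => j.
  apply: rsmooth_ext (adm_vsmooth pM sc.1 (x := p) Dp (lshift l j)) => // q.
  by rewrite mxE.
have [n [Bn BU]] := bB U' (i t) oU' (conj Dt Wt).
by exists n; split=> // u /BU [Du Wu]; apply: WU.
Qed.

Lemma induced_manifold : mhausdorff M -> msecond_countable M ->
  smooth_manifold (induced i).
Proof.
move=> hM cM; have [? ? ?] := induced_pre.
by split=> //; [exact: induced_hausdorff|exact: induced_second_countable].
Qed.

End Induced.

(** ** Submersions *)

(** The derivative of a linear map is the map itself. *)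
Lemma submersion_linear M N (F : M -> N) : premanifold M -> premanifold N ->
  (forall x, exists (c : chart R M) (c' : chart R N)
      (L : 'M[R]_(cdim c, cdim c')),
    [/\ atlas c /\ atlas c', cdom c x,
        forall y, cdom c y -> cdom c' (F y) /\ c' (F y) = c y *m L
      & forall v : 'rV[R]_(cdim c'), exists u, u *m L = v]) ->
  submersion F.
Proof.
move=> pM pN H x; have [c [c' [L [[ac ac'] dx FL sL]]]] := H x.
have [[ic oc] _] := atlas_adm pM ac.
have sm : smoothrV setT (mulmxr L).
  by apply: (smoothrV_mul L) (smoothrV_id _); exact: openT.
exists c, c', (c @` cdom c), (mulmxr L); split.
  split=> //.
  - by split=> //; exists x.
  - by move=> y dy _; apply: FL.
  - by apply/smooth_onP => //; apply: smoothrV_sub sm.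
move=> v; have [u uL] := sL v; exists u.
have := (smooth_onP _ openT).2 sm 0%N => /= cL.
rewrite diff_lin //.
by move=> w; exact: (cL w I).
Qed.

End SmoothMaps.

(** * The fibers and the fibered square *)

(** By proof irrelevance for equalities on the base, which holds for every type. *)
Lemma Tagged_inj (I : Type) (T : I -> Type) (i : I) : injective (Tagged T (i := i)).
Proof.
move=> x y xy; have := projT2_eq xy.
by rewrite (Prop_irrelevance (projT1_eq xy) erefl).
Qed.

Lemma range_sval T (S : set T) : range (@sval T S) = S.
Proof.
by apply/seteqP; split=> [_ [[x Sx] _ <-]|x Sx] //=; exists (exist _ x Sx).
Qed.

Lemma sval_inj T (S : set T) : injective (@sval T S).
Proof. by move=> [x Sx] [y Sy] /= xy; apply: eq_exist. Qed.

Section Incl.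
Variables (R : realType) (Delta : charted R) (F : Delta -> Type).
Variable E : set (chart R {delta & F delta}).

(** The map that defines [fibered_square]. *)
Definition fibered_pair (p : {delta & (F delta * F delta)%type}) :
    product (total E) (total E) :=
  (Tagged F (tagged p).1, Tagged F (tagged p).2).

Lemma fibered_pair_inj : injective fibered_pair.
Proof.
move=> [d [u v]] [d' [u' v']] uv.
have /= u_eq := congr1 fst uv; have /= v_eq := congr1 snd uv.
have dd' : d = d' := congr1 tag u_eq; subst d'.
by rewrite (Tagged_inj u_eq) (Tagged_inj v_eq).
Qed.

Lemma range_fibered_pair p : range fibered_pair p <-> tag p.1 = tag p.2.
Proof.
split=> [[q _ <-] //|]; case: p => -[d u] [d' v] /= dd'; subst d'.
by exists (existT _ d (u, v)).
Qed.

(** The map that defines [fiber]. *)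
Definition fiber_incl d (x : F d) : total E := Tagged F x.

Lemma range_fiber_incl d p : range (@fiber_incl d) p <-> tag p = d.
Proof.
split=> [[q _ <-] //|]; case: p => d' x /= dd'; subst d'.
by exists x.
Qed.

End Incl.

(** * Locally trivial families *)

Section Adapted.
Variables (R : realType) (Delta : charted R) (F : Delta -> Type).
Variable E : set (chart R {delta & F delta}).
Local Notation M := (total E).

(** The coordinates of the base come first, followed by coordinates [z] along the
   fibers. *)
Definition adapted_map m (b : chart R Delta) (z : M -> 'rV[R]_m) (p : M) :
  'rV[R]_(cdim b + m) := row_mx (b (tag p)) (z p).

(** A chart of the total space whose domain is the whole preimage of [V]: it is a
   simultaneous trivialization of the fibers over [V]. *)
Definition adapted (V : set Delta) m b (z : M -> 'rV[R]_m) : Prop :=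
  [/\ atlas b, V `<=` cdom b &
      atlas (Chart [set p : M | V (tag p)] (adapted_map b z) : chart R M)].

Hypotheses (pD : premanifold Delta) (pM : premanifold M).
Hypothesis locally_adapted : forall d, exists V m b (z : M -> 'rV[R]_m),
  V d /\ adapted V b z.

Section OneChart.
Variables (V : set Delta) (m : nat) (b : chart R Delta) (z : M -> 'rV[R]_m).
Hypothesis hV : adapted V b z.
Let a : chart R M := Chart [set p : M | V (tag p)] (adapted_map b z).

Lemma adapted_adm : admissible a.
Proof. by apply: (atlas_adm pM); case: hV. Qed.

Lemma adapted_vsmooth_tag (p : M) : V (tag p) -> vsmooth (fun q : M => b (tag q)) p.
Proof.
move=> Vp j.
apply: rsmooth_ext (adm_vsmooth pM adapted_adm (x := p) Vp (lshift m j)) => // q.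
by rewrite /= row_mxEl.
Qed.

Lemma adapted_vsmooth (p : M) : V (tag p) -> vsmooth z p.
Proof.
move=> Vp j.
apply: rsmooth_ext (adm_vsmooth pM adapted_adm (x := p) Vp (rshift _ j)) => // q.
by rewrite /= row_mxEr.
Qed.

Lemma adapted_near (p : M) : V (tag p) -> mnear p [set q | V (tag q)].
Proof. exact: (adm_dom pM adapted_adm). Qed.

Lemma adapted_inj d d' : V d -> V d' -> b d = b d' -> d = d'.
Proof.
case: hV => ab Vb _ Vd Vd'; apply: (atlas_adm pD ab).1.1; rewrite inE; exact: Vb.
Qed.

(** The coordinates [z p 0 j] with [j] in [J] are moved to the end, and the other
   ones are kept behind those of the base. *)
Lemma coordinate_slice (J : {set 'I_m}) (S : set M) :
  (forall p, V (tag p) -> (S p <-> forall j, j \in J -> z p 0 j = 0)) ->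
  exists l (z1 : M -> 'rV[R]_l) k (z2 : M -> 'rV[R]_k),
    slice_chart S [set p | V (tag p)]
      (fun p => row_mx (row_mx (b (tag p)) (z1 p)) (z2 p)).
Proof.
move=> SJ; have ada := adapted_adm.
(* [f] enumerates the complement of [J], and then [J]. *)
pose f (k : 'I_(#|~: J| + #|J|)) : 'I_m :=
  match fintype.split k with inl i => enum_val i | inr i => enum_val i end.
have fl i : f (lshift _ i) = enum_val i by rewrite /f (unsplitK (inl i)).
have fr i : f (rshift _ i) = enum_val i by rewrite /f (unsplitK (inr i)).
have injf : injective f.
  move=> i j; case: (split_ordP i) => i' ->; case: (split_ordP j) => j' ->;
    rewrite ?fl ?fr.
  - by move=> /enum_val_inj ->.
  - by move=> ij; have := enum_valP i'; rewrite ij inE enum_valP.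
  - by move=> ij; have := enum_valP j'; rewrite -ij inE enum_valP.
  - by move=> /enum_val_inj ->.
have cardf : #|'I_m| = #|'I_(#|~: J| + #|J|)|.
  by rewrite !card_ord addnC cardsC card_ord.
have [g fK gK] : bijective f by apply: inj_card_bij => //; rewrite cardf.
pose pl (w : 'rV[R]_m) : 'rV[R]_(#|~: J|) := \row_k w 0 (f (lshift _ k)).
pose pr (w : 'rV[R]_m) : 'rV[R]_(#|J|) := \row_k w 0 (f (rshift _ k)).
pose q (w : 'rV[R]_(#|~: J| + #|J|)) := \row_k w 0 (g k).
pose t (w : 'rV[R]_(cdim b + m)) :=
  row_mx (row_mx (lsubmx w) (pl (rsubmx w))) (pr (rsubmx w)).
pose t' (w : 'rV[R]_((cdim b + #|~: J|) + #|J|)) :=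
  row_mx (lsubmx (lsubmx w)) (q (row_mx (rsubmx (lsubmx w)) (rsubmx w))).
have sid d : smoothrV setT (@id 'rV[R]_d) by exact: smoothrV_id.
have scoord d e e' (h : 'I_e' -> 'I_e) (w : 'rV[R]_d -> 'rV[R]_e) :
    smoothrV setT w -> smoothrV setT (fun v => \row_k w v 0 (h k)).
  move=> sw j k; apply: (CkR_eq (f := fun v => w v 0 (h j))); first exact: openT.
    by move=> v _; rewrite mxE.
  exact: sw.
have plr w : row_mx (pl w) (pr w) = \row_k w 0 (f k).
  apply/rowP => k; rewrite mxE; case: (split_ordP k) => k' ->.
    by rewrite row_mxEl mxE.
  by rewrite row_mxEr mxE.
have tK : cancel t t'.
  move=> w; rewrite /t /t' !(row_mxKl, row_mxKr) plr.
  rewrite -[RHS]hsubmxK; congr row_mx; apply/rowP => k.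
  by rewrite [LHS]mxE [LHS]mxE gK.
have t'K : cancel t' t.
  move=> w; rewrite /t /t' !(row_mxKl, row_mxKr).
  rewrite -[RHS]hsubmxK -[in RHS](hsubmxK (lsubmx w)).
  by congr row_mx; [congr row_mx|]; apply/rowP => k; rewrite [LHS]mxE [LHS]mxE fK
    ?row_mxEl ?row_mxEr.
exists #|~: J|, (fun p => pl (z p)), #|J|, (fun p => pr (z p)); split.
  have := @adm_transport _ M a _ (cdom a) t t' pM ada.
  rewrite (_ : (fun p => t _) =
      fun p => row_mx (row_mx (b (tag p)) (pl (z p))) (pr (z p))).
    apply=> //.
    - apply: (smoothrV_row openT); first apply: (smoothrV_row openT).
      + exact: (smoothrV_lsub openT).
      + exact/scoord/(smoothrV_rsub openT).
      + exact/scoord/(smoothrV_rsub openT).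
    - apply: (smoothrV_row openT); last apply: scoord.
        exact/(smoothrV_lsub openT)/(smoothrV_lsub openT).
      apply: (smoothrV_row openT); last exact: (smoothrV_rsub openT).
      exact/(smoothrV_rsub openT)/(smoothrV_lsub openT).
    - exact: (adm_mopen pM ada).
  by apply/funext => p; rewrite /t /= /adapted_map row_mxKl row_mxKr.
move=> p Vp; rewrite row_mxKr; apply: (iff_trans (SJ p Vp)).
split=> [zJ|/rowP prz j jJ].
  by apply/rowP => k; rewrite !mxE fr; apply: zJ; apply: enum_valP.
by have := prz (enum_rank_in jJ j); rewrite !mxE fr enum_rankK_in.
Qed.

End OneChart.

Lemma tag_smooth (p : M) : smooth_at (fun q : M => tag q : Delta) p.
Proof.
have [V [m [b [z [Vp hV]]]]] := locally_adapted (tag p).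
have [ab Vb _] := hV; apply: (smooth_at_atlas pM ab).
  by apply: mnearS (adapted_near hV Vp) => q; apply: Vb.
exact: (adapted_vsmooth_tag hV Vp).
Qed.

Lemma tag_submersion : submersion (fun q : M => tag q : Delta).
Proof.
apply: submersion_linear => // p.
have [V [m [b [z [Vp [ab Vb aa]]]]]] := locally_adapted (tag p).
exists (Chart [set p : M | V (tag p)] (adapted_map b z)), b, (col_mx 1%:M 0).
split=> // [q Vq|v].
  by split; [exact: Vb|rewrite /= mul_row_col mulmx1 mulmx0 addr0].
by exists (row_mx v 0); rewrite mul_row_col mulmx1 mulmx0 addr0.
Qed.

(** Over [d] the coordinates of the base are constant.  Minus this constant, and moved
   to the end, they are the equations of a slice. *)
Lemma fiber_submanifold d : submanifold (range (@fiber_incl R Delta F E d)).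
Proof.
move=> p /range_fiber_incl pd.
have [V [m [b [z [Vp hV]]]]] := locally_adapted (tag p).
have Vd : V d by rewrite -pd.
have ada := adapted_adm hV.
pose t (w : 'rV[R]_(cdim b + m)) := row_mx (rsubmx w) (lsubmx w - b d).
pose t' (w : 'rV[R]_(m + cdim b)) := row_mx (rsubmx w + b d) (lsubmx w).
exists m, (cdim b), [set p : M | V (tag p)], (fun p => t (adapted_map b z p)).
split=> //; split.
  apply: (@adm_transport _ M (Chart [set p : M | V (tag p)] (adapted_map b z))
    _ _ t t' pM ada) => //.
  - apply: smoothrV_row; [exact: openT|apply: smoothrV_rsub|apply: smoothrVB];
      do ?[exact: openT|exact: smoothrV_id|exact: smoothrV_cst].
    by apply: smoothrV_lsub; [exact: openT|exact: smoothrV_id].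
  - apply: smoothrV_row; [exact: openT|apply: smoothrVD|apply: smoothrV_lsub];
      do ?[exact: openT|exact: smoothrV_id|exact: smoothrV_cst].
    by apply: smoothrV_rsub; [exact: openT|exact: smoothrV_id].
  - by move=> w; rewrite /t /t' row_mxKl row_mxKr subrK hsubmxK.
  - by move=> w; rewrite /t /t' row_mxKl row_mxKr addrK hsubmxK.
  - exact: (adm_mopen pM ada).
move=> q Vq; rewrite /t /adapted_map !row_mxKr row_mxKl; split.
  by move=> /range_fiber_incl ->; rewrite subrr.
by move=> /subr0_eq qd; apply/range_fiber_incl/(adapted_inj hV).
Qed.

(** Two points that lie over [V] are in the same fiber if and only if the
   differences of their coordinates on the base vanish.  As an adapted chart
   contains whole fibers, it can be used for both points. *)
Lemma fibered_pair_submanifold : submanifold (range (@fibered_pair R Delta F E)).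
Proof.
move=> p /range_fibered_pair pp.
have [V [m [b [z [Vp hV]]]]] := locally_adapted (tag p.1).
have aa : atlas (Chart [set p : M | V (tag p)] (adapted_map b z) : chart R M).
  by case: hV.
have ada := prod_chart_adm pM pM aa aa.
pose t (w : 'rV[R]_((cdim b + m) + (cdim b + m))) :=
  row_mx (row_mx (lsubmx w) (rsubmx (rsubmx w)))
         (lsubmx (rsubmx w) - lsubmx (lsubmx w)).
pose t' (w : 'rV[R]_((cdim b + m + m) + cdim b)) :=
  row_mx (lsubmx (lsubmx w))
    (row_mx (rsubmx w + lsubmx (lsubmx (lsubmx w))) (rsubmx (lsubmx w))).
pose D := cdom (prod_chart (Chart [set p : M | V (tag p)] (adapted_map b z))
  (Chart [set p : M | V (tag p)] (adapted_map b z))).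
exists (cdim b + m + m)%N, (cdim b), D, (fun p => t (row_mx (adapted_map b z p.1)
  (adapted_map b z p.2))).
have sid d : smoothrV setT (@id 'rV[R]_d) by exact: smoothrV_id.
split; first by split=> //=; rewrite -pp.
split.
  apply: (@adm_transport _ (product M M) (prod_chart
    (Chart [set p : M | V (tag p)] (adapted_map b z))
    (Chart [set p : M | V (tag p)] (adapted_map b z))) _ _ t t'
    (product_pre pM pM) ada) => //.
  - apply: (smoothrV_row openT); first apply: (smoothrV_row openT).
    + exact: (smoothrV_lsub openT).
    + exact/(smoothrV_rsub openT)/(smoothrV_rsub openT).
    + apply: (smoothrVB openT).
        exact/(smoothrV_lsub openT)/(smoothrV_rsub openT).
      exact/(smoothrV_lsub openT)/(smoothrV_lsub openT).
  - apply: (smoothrV_row openT); last apply: (smoothrV_row openT).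
    + exact/(smoothrV_lsub openT)/(smoothrV_lsub openT).
    + apply: (smoothrVD openT); first exact: (smoothrV_rsub openT).
      exact/(smoothrV_lsub openT)/(smoothrV_lsub openT)/(smoothrV_lsub openT).
    + exact/(smoothrV_rsub openT)/(smoothrV_lsub openT).
  - by move=> w; rewrite /t /t' !(row_mxKl, row_mxKr) subrK !hsubmxK.
  - by move=> w; rewrite /t /t' !(row_mxKl, row_mxKr) addrK !hsubmxK.
  - exact: (adm_mopen (product_pre pM pM) ada).
move=> q [Vq1 Vq2]; rewrite /t /adapted_map !(row_mxKr, row_mxKl); split.
  by move=> /range_fibered_pair ->; rewrite subrr.
by move=> /subr0_eq qq; apply/range_fibered_pair/(adapted_inj hV).
Qed.

Lemma fibered_square_pre : premanifold (fibered_square E).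
Proof.
apply: (induced_pre (i := @fibered_pair R Delta F E)).
- exact: product_pre.
- exact: fibered_pair_inj.
- exact: fibered_pair_submanifold.
Qed.

Lemma fiber_manifold d : smooth_manifold M -> smooth_manifold (fiber E d).
Proof.
move=> [_ _ _ hM cM].
apply: (induced_manifold (i := @fiber_incl R Delta F E d)) => //.
  exact: Tagged_inj.
exact: fiber_submanifold.
Qed.

(** ** Subfamilies *)

(** Closedness holds because the coordinates are continuous.  As the coordinates of
   the base are not affected, they are still the first coordinates of the charts of
   the subset, on which the projection is therefore a submersion. *)
Lemma coordinate_subfamily (C : forall d, set (F d)) :
  (forall d, exists V m b (z : M -> 'rV[R]_m) (J : {set 'I_m}),
    [/\ V d, adapted V b z &
      forall p, V (tag p) -> (C (tag p) (tagged p) <->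
        forall j, j \in J -> z p 0 j = 0)]) ->
  closed_subfamily E C.
Proof.
move=> H; set S : set M := [set p | C (tag p) (tagged p)].
have H' (p : M) : exists V m b (z : M -> 'rV[R]_m) l (z1 : M -> 'rV[R]_l) k
    (z2 : M -> 'rV[R]_k),
  [/\ V (tag p), adapted V b z & slice_chart S [set p | V (tag p)]
        (fun p => row_mx (row_mx (b (tag p)) (z1 p)) (z2 p))].
  have [V [m [b [z [J [Vp hV SJ]]]]]] := H (tag p).
  have [l [z1 [k [z2 sc]]]] := coordinate_slice hV SJ.
  by exists V, m, b, z, l, z1, k, z2.
have subS : submanifold S.
  move=> p _; have [V [m [b [z [l [z1 [k [z2 [Vp _ sc]]]]]]]]] := H' p.
  by exists (cdim b + l)%N, k, [set p | V (tag p)],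
    (fun p => row_mx (row_mx (b (tag p)) (z1 p)) (z2 p)).
have pS : premanifold (subspace_of S).
  apply: (induced_pre (i := @sval M S)) => //; first exact: sval_inj.
  by rewrite range_sval.
split=> //.
  apply/(mopenP pM) => p nSp; have [V [m [b [z [J [Vp hV SJ]]]]]] := H (tag p).
  have [j jJ zj] : exists2 j, j \in J & z p 0 j != 0.
    apply: contra_notP nSp => nz; apply/(SJ p Vp) => j jJ.
    by apply/eqP/negP => /negP zj; apply: nz; exists j.
  have nz := rsmooth_near pM (adapted_vsmooth hV Vp j) (@open_neq R 0) zj.
  apply: mnearS (mnearI pM (adapted_near hV Vp) nz) => q [Vq /= zq] /(SJ q Vq) zJ.
  by move: zq; rewrite zJ // eqxx.
apply: submersion_linear => // s.
have [V [m [b [z [l [z1 [k [z2 [Vp hV sc]]]]]]]]] := H' (sval s).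
have [ab Vb _] := hV.
rewrite -[S in slice_chart S]range_sval in sc.
exists (induced_chart (@sval M S) [set p | V (tag p)]
  (fun p => row_mx (row_mx (b (tag p)) (z1 p)) (z2 p))), b, (col_mx 1%:M 0).
split=> //; first by split=> //; exact: induced_chart_atlas.
  move=> y Vy; split; first exact: Vb.
  by rewrite /= row_mxKl mul_row_col mulmx1 mulmx0 addr0.
by move=> v; exists (row_mx v 0); rewrite mul_row_col mulmx1 mulmx0 addr0.
Qed.

End Adapted.

(** * Finite-dimensional algebras *)
Section Coordinates.
Variables (R : realType) (A : algebra R) (r : nat).
Variables (Phi : A -> 'rV[R]_r) (Psi : 'rV[R]_r -> A).
Hypotheses (linPhi : linear Phi) (PhiK : cancel Phi Psi) (PsiK : cancel Psi Phi).

(** The axioms of [algebra], for the multiplication of the ring structure. *)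
Lemma scaleAl k (x y : A) : k *: (x * y) = (k *: x) * y.
Proof. exact: alg_scalerAl. Qed.

Lemma scaleAr k (x y : A) : k *: (x * y) = x * (k *: y).
Proof. exact: alg_scalerAr. Qed.

Lemma Phi0 : Phi 0 = 0.
Proof. by have := linPhi (-1) 0 0; rewrite scaler0 addr0 scaleN1r addNr. Qed.

Lemma PhiD x y : Phi (x + y) = Phi x + Phi y.
Proof. by have := linPhi 1 x y; rewrite !scale1r. Qed.

Lemma PhiZ a x : Phi (a *: x) = a *: Phi x.
Proof. by have := linPhi a x 0; rewrite !addr0 Phi0 addr0. Qed.

Lemma Phi_sum I (s : seq I) (P : pred I) (F : I -> A) :
  Phi (\sum_(i <- s | P i) F i) = \sum_(i <- s | P i) Phi (F i).
Proof. exact: (big_morph Phi PhiD Phi0). Qed.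

Lemma Psi_linear : linear Psi.
Proof. by move=> a u v; rewrite -[RHS]PhiK linPhi !PsiK. Qed.

Lemma Psi_basis x : x = \sum_a Phi x 0 a *: Psi (delta_mx 0 a).
Proof.
apply: (can_inj PhiK); rewrite Phi_sum [LHS](row_sum_delta (Phi x)).
by apply: eq_bigr => a _; rewrite PhiZ PsiK.
Qed.

Lemma Phi_mul x y : Phi (x * y) = \sum_a \sum_b
  (Phi x 0 a * Phi y 0 b) *: Phi (Psi (delta_mx 0 a) * Psi (delta_mx 0 b)).
Proof.
rewrite {1}[x]Psi_basis {1}[y]Psi_basis mulr_suml Phi_sum.
apply: eq_bigr => a _; rewrite mulr_sumr Phi_sum; apply: eq_bigr => b _.
by rewrite -PhiZ -[in LHS]scaleAl -[in LHS]scaleAr scalerA.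
Qed.

Variable N : nat.
Implicit Types X Y Z : 'M[A]_N.

(** The real coordinates of a matrix that are used in [matrix_bundle]. *)
Definition mxcoord X : 'rV[R]_(N * N * r) :=
  mxvec (\matrix_(k, l) Phi (mxvec X 0 k) 0 l).

Definition mxuncoord (v : 'rV[R]_(N * N * r)) : 'M[A]_N :=
  \matrix_(i, j) Psi (row (mxvec_index i j) (vec_mx v)).

Lemma mxcoordE X i j l :
  mxcoord X 0 (mxvec_index (mxvec_index i j) l) = Phi (X i j) 0 l.
Proof. by rewrite mxvecE mxE mxvecE. Qed.

Lemma mxcoordP X v :
  (forall i j, Phi (X i j) = row (mxvec_index i j) (vec_mx v)) -> mxcoord X = v.
Proof.
move=> H; apply/rowP => p; case/mxvec_indexP: p => k l.
case/mxvec_indexP: k => i j; rewrite mxcoordE H mxE.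
by rewrite -[in RHS](vec_mxK v) mxvecE.
Qed.

Lemma mxuncoordK : cancel mxuncoord mxcoord.
Proof. by move=> v; apply: mxcoordP => i j; rewrite mxE PsiK. Qed.

Lemma Phi_mxcoord X i j : Phi (X i j) = row (mxvec_index i j) (vec_mx (mxcoord X)).
Proof. by apply/rowP => l; rewrite mxE mxvecK mxE mxvecE. Qed.

Lemma mxcoordK : cancel mxcoord mxuncoord.
Proof. by move=> X; apply/matrixP => i j; rewrite mxE -Phi_mxcoord PhiK. Qed.

Lemma mxuncoord_linear a u v i j :
  mxuncoord (a *: u + v) i j = a *: mxuncoord u i j + mxuncoord v i j.
Proof. by rewrite !mxE !linearP; apply: Psi_linear. Qed.

Definition lmul X (v : 'rV[R]_(N * N * r)) := mxcoord (X * mxuncoord v).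

Lemma lmul_linear X : linear (lmul X).
Proof.
move=> a u v; apply: mxcoordP => i j.
rewrite linearP /= linearP /= -!Phi_mxcoord -linPhi; congr Phi.
rewrite !mxE scaler_sumr -big_split; apply: eq_bigr => k _ /=.
by rewrite mxuncoord_linear mulrDr -[in LHS]scaleAr.
Qed.

HB.instance Definition _ X := GRing.isLinear.Build _ _ _ _ _ (lmul_linear X).

(** The matrix of the left multiplication by [X] in these coordinates; as it acts on
   row vectors, [lmul_mx] reverses products ([lmul_mxM]). *)
Definition lmul_mx X : 'M[R]_(N * N * r) :=
  lin1_mx (lmul X).

Lemma mxcoord_mul X Z : mxcoord (X * Z) = mxcoord Z *m lmul_mx X.
Proof. by rewrite mul_rV_lin1 /= /lmul mxcoordK. Qed.

Lemma lmul_mxE X j i :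
  lmul_mx X j i = mxcoord (X * mxuncoord (delta_mx 0 j)) 0 i.
Proof. by rewrite mxE. Qed.

Lemma mxcoord_inj_mx (B C : 'M[R]_(N * N * r)) :
  (forall Z : 'M[A]_N, mxcoord Z *m B = mxcoord Z *m C) -> B = C.
Proof.
by move=> H; apply/row_matrixP => i; rewrite !rowE -[delta_mx 0 i]mxuncoordK H.
Qed.

Lemma lmul_mxM X Y : lmul_mx (X * Y) = lmul_mx Y *m lmul_mx X.
Proof.
by apply: mxcoord_inj_mx => Z; rewrite mulmxA -!mxcoord_mul mulrA.
Qed.

Lemma lmul_mx1 : lmul_mx 1 = 1%:M.
Proof. by apply: mxcoord_inj_mx => Z; rewrite -mxcoord_mul mul1r mulmx1. Qed.

(** Square real matrices have this property, and [lmul_mx] is injective, as it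
   determines the product with [1]. *)
Lemma mulmx_rinv_linv X Y : X * Y = 1 -> Y * X = 1.
Proof.
move=> XY; have := congr1 lmul_mx XY; rewrite lmul_mxM lmul_mx1 => /mulmx1C.
rewrite -lmul_mxM -lmul_mx1 => E; apply: (can_inj mxcoordK).
by rewrite -[Y * X]mulr1 mxcoord_mul E -mxcoord_mul mulr1.
Qed.

(** If left multiplication by [X] is surjective, then [1] is in its image, so that
   [X] has a right inverse. *)
Lemma invertible_lmul X : invertible X <-> lmul_mx X \in unitmx.
Proof.
split=> [[Y [YX XY]]|uX].
  have := congr1 lmul_mx XY; rewrite lmul_mxM lmul_mx1 => /mulmx1_unit.
  by case.
pose Y := mxuncoord (mxcoord 1 *m invmx (lmul_mx X)).
have XY : X * Y = 1.
  by apply: (can_inj mxcoordK); rewrite mxcoord_mul mxuncoordK mulmxKV.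
by exists Y; split=> //; apply: mulmx_rinv_linv.
Qed.

Lemma mxcoord_inv X Y : X * Y = 1 ->
  mxcoord Y = mxcoord 1 *m invmx (lmul_mx X).
Proof.
move=> XY; have uX : lmul_mx X \in unitmx.
  by apply/invertible_lmul; exists Y; split=> //; apply: mulmx_rinv_linv.
by rewrite -XY mxcoord_mul mulmxK.
Qed.

End Coordinates.

(** * Smooth families of algebras in a local trivialization *)

Section Family.
Variables (R : realType) (Delta : charted R).
Variables (A : Delta -> algebra R) (E : set (chart R {delta & A delta})).
Hypothesis hA : smooth_family_of_algebras E.

Lemma base_manifold : smooth_manifold Delta.
Proof. by case: hA => [[]]. Qed.

Lemma base_pre : premanifold Delta.
Proof. exact/smooth_premanifold/base_manifold. Qed.

Lemma bundle_pre : premanifold (total E).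
Proof. by case: hA => -[_ /smooth_premanifold]. Qed.

Lemma exists_trivialization delta : exists U r Phi Psi,
  U delta /\ @local_trivialization R Delta (fun delta => A delta) E U r Phi Psi.
Proof. by case: hA => -[_ _ _ /(_ delta)]. Qed.

Section Trivialization.
Variables (U : set Delta) (r : nat) (Phi : forall delta, A delta -> 'rV[R]_r)
  (Psi : forall delta, 'rV[R]_r -> A delta).
Hypothesis hL : @local_trivialization R Delta (fun delta => A delta) E U r Phi Psi.

Lemma triv_open : mopen U. Proof. by case: hL. Qed.
Lemma triv_linear d : U d -> linear (Phi (delta := d)).
Proof. by case: hL => _ H _ _ _; apply: H. Qed.
Lemma trivK d : U d -> cancel (Phi (delta := d)) (@Psi d).
Proof. by case: hL => _ _ H _ _ /H []. Qed.
Lemma triv_invK d : U d -> cancel (@Psi d) (Phi (delta := d)).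
Proof. by case: hL => _ _ H _ _ /H []. Qed.

Section Over.
Variables (P : charted R) (t : P -> Delta) (x : P).
Hypotheses (pP : premanifold P) (st : smooth_at t x) (Ux : U (t x)).

Lemma triv_near : mnear x (t @^-1` U).
Proof.
apply: (smooth_at_near base_pre st); apply: mopen_mnear => //.
  exact: base_pre.
exact: triv_open.
Qed.

Lemma smooth_at_triv (v : 'rV[R]_r) :
  smooth_at (fun y =>
    (Tagged (fun delta => A delta : Type) (Psi (t y) v) : total E)) x.
Proof.
have pE := euclidean_pre (R := R) r.
have pB := product_pre base_pre pE.
have sp : smooth_at (fun y => (t y, v) : product Delta (euclidean r)) x.
  apply: smooth_pair => //; first exact: base_pre.
  exact: smooth_at_cst.
case: hL => _ _ _ _ /(_ (t x, v) Ux) sPsi.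
exact: (smooth_at_comp pP pB bundle_pre sp sPsi).
Qed.

Lemma vsmooth_triv (e : forall y, A (t y)) :
  smooth_at (fun y => (Tagged (fun delta => A delta : Type) (e y) : total E)) x ->
  vsmooth (fun y => Phi (e y)) x.
Proof.
move=> se; have pE := euclidean_pre (R := R) r.
have pB := product_pre base_pre pE.
case: hL => _ _ _ /(_ (Tagged (fun delta => A delta : Type) (e x)) Ux) sPhi _.
have := smooth_at_comp pP bundle_pre pB se sPhi.
move=> sT; have := smooth_at_comp pP pB pE sT (smooth_snd base_pre pE _).
by move/(euclidean_vsmooth _ _ pP).
Qed.

End Over.

(** The product of two sections with constant coordinates is a composite of smooth
   maps: the pair of sections is smooth as a map to the fibered square because it is
   so as a map to the product.  For this the fibered square has to be a submanifold,
   which follows from the smoothness of the multiplication, as this provides a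
   chart at each point. *)
Lemma structure_constant_smooth d (a b c : 'I_r) : U d ->
  rsmooth (fun y : Delta =>
    Phi (Psi y (delta_mx 0 a) * Psi y (delta_mx 0 b)) 0 c) d.
Proof.
move=> Ud; have pB := product_pre bundle_pre bundle_pre.
have sid := smooth_at_id d base_pre.
have sa := smooth_at_triv base_pre sid Ud (delta_mx 0 a).
have sb := smooth_at_triv base_pre sid Ud (delta_mx 0 b).
case: hA => _ smul _.
have sub : submanifold (range (@fibered_pair R Delta (fun d => A d : Type) E)).
  move=> _ [q _ <-]; have [c' [_ [_ [_ [[ac _] [dq _] _ _ _]]]]] := smul q.
  move: ac => [k [l [D [phi [sc cE]]]]]; rewrite cE in dq.
  by exists k, l, D, phi.
pose s (y : Delta) : fibered_square E :=
  existT (fun delta => (A delta * A delta)%type) y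
    (Psi y (delta_mx 0 a), Psi y (delta_mx 0 b)).
have ss : smooth_at s d.
  apply: (smooth_into_induced
    (i := @fibered_pair R Delta (fun d => A d : Type) E) pB sub base_pre).
  exact: (smooth_pair bundle_pre bundle_pre base_pre sa sb).
have pF : premanifold (fibered_square E).
  exact: (induced_pre pB (@fibered_pair_inj _ _ _ _) sub).
have sm := smooth_at_comp base_pre pF bundle_pre ss (smul (s d)).
exact: (vsmooth_triv (t := fun y => y)
  (e := fun y => Psi y (delta_mx 0 a) * Psi y (delta_mx 0 b)) base_pre Ud sm c).
Qed.

Section Over2.
Variables (P : charted R) (t : P -> Delta) (x : P).
Hypotheses (pP : premanifold P) (st : smooth_at t x) (Ux : U (t x)).

Lemma vsmooth_mul (X Y : forall y, A (t y)) :
  vsmooth (fun y => Phi (X y)) x -> vsmooth (fun y => Phi (Y y)) x ->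
  vsmooth (fun y => Phi (X y * Y y)) x.
Proof.
move=> sX sY c; apply: (rsmooth_eq pP (f := fun y => \sum_a \sum_b
   Phi (X y) 0 a * Phi (Y y) 0 b *
   Phi (Psi (t y) (delta_mx 0 a) * Psi (t y) (delta_mx 0 b)) 0 c)).
  apply: mnearS (triv_near st Ux) => y Uy /=.
  rewrite (Phi_mul (triv_linear Uy) (trivK Uy) (triv_invK Uy)) summxE.
  by apply: eq_bigr => a _; rewrite summxE; apply: eq_bigr => b _; rewrite mxE.
apply: rsmooth_sum => // a _; apply: rsmooth_sum => // b _.
apply: rsmoothM => //; first exact: rsmoothM.
exact: (smooth_at_rsmooth base_pre st (structure_constant_smooth a b c Ux)).
Qed.

Lemma vsmooth_one : vsmooth (fun y => Phi (1 : A (t y))) x.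
Proof.
apply: vsmooth_triv => //; case: hA => _ _ sone.
exact: (smooth_at_comp pP base_pre bundle_pre st (sone (t x))).
Qed.

Variable N : nat.

(** Smoothness of the entries of a family of matrices over the map [t] to the base, in
   a trivialization near [t x]. *)
Definition mx_smooth (X : forall y, 'M[A (t y)]_N) : Prop :=
  forall i j, vsmooth (fun y => Phi (X y i j)) x.

Lemma mx_smooth_mul (X Y : forall y, 'M[A (t y)]_N) : mx_smooth X -> mx_smooth Y ->
  mx_smooth (fun y => X y * Y y).
Proof.
move=> sX sY i j c; apply: (rsmooth_eq pP (f := fun y => \sum_k
   Phi (X y i k * Y y k j) 0 c)).
  apply: mnearS (triv_near st Ux) => y Uy /=.
  by rewrite mxE (Phi_sum (triv_linear Uy)) summxE.
by apply: rsmooth_sum => // k _; apply: vsmooth_mul.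
Qed.

Lemma mx_smooth1 : mx_smooth (fun y => 1).
Proof.
move=> i j; have [->|ij] := eqVneq i j.
  move=> c; apply: rsmooth_ext (vsmooth_one c) => // y.
  by rewrite mxE eqxx.
move=> c; apply: (rsmooth_eq pP (f := fun=> 0)); last exact: rsmooth_cst.
apply: mnearS (triv_near st Ux) => y Uy /=.
by rewrite mxE (negbTE ij) (Phi0 (triv_linear Uy)) mxE.
Qed.

Lemma mx_smooth_uncoord v :
  mx_smooth (fun y => mxuncoord (@Psi (t y)) v).
Proof.
move=> i j c.
apply: (rsmooth_eq pP (f := fun=> row (mxvec_index i j) (vec_mx v) 0 c)).
  by apply: mnearS (triv_near st Ux) => y Uy /=; rewrite [in RHS]mxE triv_invK.
exact: rsmooth_cst.
Qed.

Lemma mx_smoothP (X : forall y, 'M[A (t y)]_N) :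
  mx_smooth X <-> vsmooth (fun y => mxcoord (@Phi (t y)) (X y)) x.
Proof.
split=> [sX p|sX i j l].
  case/mxvec_indexP: p => k l; case/mxvec_indexP: k => i j.
  by apply: rsmooth_ext (sX i j l) => // y; rewrite mxcoordE.
apply: rsmooth_ext (sX (mxvec_index (mxvec_index i j) l)) => // y.
by rewrite mxcoordE.
Qed.

Implicit Types X Y : forall y, 'M[A (t y)]_N.

Let L (X : forall y, 'M[A (t y)]_N) y := lmul_mx (@Phi (t y)) (@Psi (t y)) (X y).

Lemma lmul_smooth X : mx_smooth X -> forall i j, rsmooth (fun y => L X y i j) x.
Proof.
move=> sX i j.
have /mx_smoothP/(_ j) := mx_smooth_mul sX (mx_smooth_uncoord (delta_mx 0 i)).
by apply: rsmooth_ext => // y; rewrite lmul_mxE.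
Qed.

(** Invertibility of [lmul_mx] is an open condition. *)
Lemma mx_invertible_near X : mx_smooth X -> invertible (X x) ->
  mnear x [set y | invertible (X y)].
Proof.
move=> sX; have iff y (Uy : U (t y)) := invertible_lmul (triv_linear Uy) (trivK Uy)
  (triv_invK Uy) (X y).
move=> /(iff x Ux) uX; have [nu _] := rsmooth_invmx pP (lmul_smooth sX) uX.
by apply: mnearS (mnearI pP (triv_near st Ux) nu) => y [Uy uy]; apply/iff.
Qed.

(** [Y] is the solution of the linear system [X * Y = 1] with matrix [lmul_mx X]. *)
Lemma mx_smooth_inv X Y : mx_smooth X -> (forall y, X y * Y y = 1) -> mx_smooth Y.
Proof.
move=> sX XY.
have E1 y (Uy : U (t y)) := mxcoord_inv (triv_linear Uy) (trivK Uy)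
  (triv_invK Uy) (XY y).
have uX : L X x \in unitmx.
  apply/(invertible_lmul (triv_linear Ux) (trivK Ux) (triv_invK Ux)).
  exists (Y x); split; last exact: XY.
  exact: (mulmx_rinv_linv (triv_linear Ux) (trivK Ux) (triv_invK Ux)).
have [_ sinv] := rsmooth_invmx pP (lmul_smooth sX) uX.
apply/mx_smoothP => j; apply: (rsmooth_eq pP (f := fun y => \sum_k
  mxcoord (@Phi (t y)) (1 : 'M[A (t y)]_N) 0 k * invmx (L X y) k j)).
  by apply: mnearS (triv_near st Ux) => y Uy /=; rewrite E1 // [in RHS]mxE.
apply: rsmooth_sum => // k _; apply: rsmoothM => //.
exact: ((mx_smoothP _).1 mx_smooth1 k).
Qed.

End Over2.
End Trivialization.
End Family.

(** * Separation and countability *)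

Section Topology.
Context {R : realType}.
Variable M : charted R.
Hypothesis pM : premanifold M.

Lemma mopen_preim m (c : chart R M) (t : M -> 'rV[R]_m) (W : set 'rV[R]_m) :
  admissible c -> (forall x, cdom c x -> vsmooth t x) -> open W ->
  mopen (cdom c `&` t @^-1` W).
Proof.
move=> ac st oW; apply/(mopenP pM) => x [dx Wx].
by apply: mnearI => //; [apply: adm_dom|apply: vsmooth_near => //; apply: st].
Qed.

(** Euclidean spaces are Hausdorff, and the domain of the chart is open. *)
Lemma chart_separated (c : chart R M) (x y : M) : atlas c -> cdom c x -> cdom c y ->
  x <> y -> exists U V : set M, [/\ mopen U, mopen V, U x, V y & U `&` V = set0].
Proof.
move=> ac dx dy xy; have adc := atlas_adm pM ac.
have cxy : c x != c y.
  by apply/eqP => cxy; apply: xy; apply: adc.1.1; rewrite ?inE.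
have := @norm_hausdorff _ 'rV[R]_(cdim c); rewrite open_hausdorff.
move=> /(_ _ _ cxy) [[U V] [/= /set_mem Ux /set_mem Vy] [oU oV /eqP UV]].
have sc z : cdom c z -> vsmooth c z by apply: adm_vsmooth.
exists (cdom c `&` c @^-1` U), (cdom c `&` c @^-1` V); split=> //.
- exact: mopen_preim.
- exact: mopen_preim.
- apply/seteqP; split=> // z [[_ Uz] [_ Vz]].
  by have : (U `&` V) (c z); [split|rewrite UV].
Qed.

(** A countable basis is given by the preimages, in countably many charts, of balls
   with rational centers and with radii [k.+1%:R^-1]. *)
Lemma second_countable_of_charts (G : set nat) (c : nat -> chart R M) :
  (forall n, G n -> atlas (c n)) -> (forall x, exists2 n, G n & cdom (c n) x) ->
  msecond_countable M.
Proof.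
move=> Gc cover.
pose K : countType := {n : nat & ('rV[rat]_(cdim (c n)) * nat)%type}.
pose box (k : K) : set M := [set x | [/\ G (tag k), cdom (c (tag k)) x &
  ball (map_mx ratr (tagged k).1 : 'rV[R]__) (tagged k).2.+1%:R^-1 (c (tag k) x)]].
exists (fun i => if unpickle i is Some k then box k else set0).
split=> [i|U x oU Ux].
  case: (unpickle i) => [k|]; last by apply/(mopenP pM).
  have [Gk|nG] := pselect (G (tag k)); last first.
    by apply/(mopenP pM) => y [].
  have ak := atlas_adm pM (Gc _ Gk).
  rewrite (_ : box k = cdom (c (tag k)) `&` c (tag k) @^-1` ball
      (map_mx ratr (tagged k).1 : 'rV[R]__) (tagged k).2.+1%:R^-1).
    by apply: mopen_preim => // [y|]; [apply: adm_vsmooth|apply: ball_open].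
  by apply/seteqP; split=> y [].
have [n Gn dx] := cover x; have adc := atlas_adm pM (Gc n Gn).
have oW := oU (c n) (Gc n Gn).
have /nbhs_ballP [e /= e0 eW] : nbhs (c n x) (c n @` (cdom (c n) `&` U)).
  by apply: open_nbhs_nbhs; split=> //; exists x.
have [k] : exists k : nat, (0 : R) + k.+1%:R^-1 < e / 2.
  by apply: ltr_add_invr; rewrite divr_gt0.
rewrite add0r; set d : R := k.+1%:R^-1 => de.
have d0 : 0 < d by rewrite invr_gt0.
have /choice [q qP] : forall j, exists q : rat, `|c n x 0 j - ratr q| < d.
  move=> j; have : c n x 0 j - d < c n x 0 j + d.
    by rewrite ltrD2l -subr_gt0 opprK addr_gt0.
  move=> /rat_in_itvoo [q]; rewrite in_itv /= => qd.
  by exists q; rewrite ltr_distlC.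
pose kk : K := existT _ n (\row_j q j, k).
exists (pickle kk); rewrite pickleK; split.
  split=> //=; split=> // i j; rewrite !mxE (ord1 i) /ball /= distrC.
  exact: qP.
move=> y [_ /= dy [_ qy]].
have /eW [z [dz Uz] zy] : ball (c n x) e (c n y).
  split=> // i j; rewrite (ord1 i) /ball /=.
  have := qy 0 j; rewrite !mxE /ball /= => qyj.
  rewrite -(subrKA (ratr (q j))) (splitr e) (le_lt_trans (ler_normD _ _)) //.
  by apply: ltrD; apply: lt_trans de.
by rewrite (_ : y = z) //; apply: adc.1.1; rewrite ?inE.
Qed.

End Topology.

(** * The bundle of matrices *)

Section MatrixBundle.
Variables (R : realType) (Delta : charted R).
Variables (A : Delta -> algebra R) (E : set (chart R {delta & A delta})).
Hypothesis hA : smooth_family_of_algebras E.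
Variable N : nat.

Local Notation MB := (total (matrix_bundle E N)).
Let pD := base_pre hA.

Section MatrixChart.
Variables (b : chart R Delta) (ab : atlas b).
Variables (U : set Delta) (r : nat) (Phi : forall delta, A delta -> 'rV[R]_r)
  (Psi : forall delta, 'rV[R]_r -> A delta).
Hypothesis hL : @local_trivialization R Delta (fun delta => A delta) E U r Phi Psi.

(** The charts that define [matrix_bundle]. *)
Definition matrix_chart : chart R MB :=
  Chart [set p | cdom b (tag p) /\ U (tag p)]
    (fun p => row_mx (b (tag p)) (mxcoord (Phi (delta := tag p)) (tagged p))).

Lemma matrix_chart_atlas : atlas matrix_chart.
Proof. by exists b, U, r, Phi, Psi. Qed.

Lemma matrix_chart_image (V : set Delta) :
  matrix_chart @` (cdom matrix_chart `&` [set p | V (tag p)]) =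
  lsubmx @^-1` (b @` (cdom b `&` (U `&` V))).
Proof.
apply/seteqP; split=> w /=.
  by move=> [p [[dp Up] Vp] <-]; rewrite row_mxKl; exists (tag p).
move=> [d [dd [Ud Vd]] dw].
exists (Tagged (fun delta => 'M[A delta]_N) (mxuncoord (@Psi d) (rsubmx w))) => //=.
rewrite mxuncoordK; last exact: (triv_invK hL).
by rewrite dw hsubmxK.
Qed.

Let lsub_smooth : smoothrV setT (lsubmx : 'rV[R]_(cdim b + N * N * r) -> _).
Proof. exact/smoothrV_lsub/smoothrV_id/openT. Qed.

Lemma matrix_chart_open (V : set Delta) : mopen V ->
  open (matrix_chart @` (cdom matrix_chart `&` [set p | V (tag p)])).
Proof.
move=> oV; rewrite matrix_chart_image; apply: open_preimT lsub_smooth.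
have oUV : mopen (U `&` V) by apply: (mopenI pD) => //; apply: (triv_open hL).
by apply: (adm_open pD (atlas_adm pD ab)) => x; apply: mopen_mnear.
Qed.

Lemma matrix_chart_is_chart : is_chart matrix_chart.
Proof.
split; last first.
  have := @matrix_chart_open setT; rewrite (_ : [set p | _] = setT) ?setIT //.
  by apply; apply/(mopenP pD) => x _; apply: mnearT.
move=> [d X] [d' X']; rewrite !inE => -[/= db Ud] [db' Ud'] /eq_row_mx [dd' XX'].
have dE : d = d' by apply: (atlas_adm pD ab).1.1; rewrite ?inE.
subst d'; by rewrite (can_inj (mxcoordK (N := N) (trivK hL Ud)) XX').
Qed.

Lemma matrix_chart_rsmooth_tag f (p : MB) : rsmooth_in b f (tag p) ->
  rsmooth_in matrix_chart (fun q => f (tag q)) p.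
Proof.
move=> [W [h [oW Wx sh fh]]]; have oW' := open_preimT oW lsub_smooth.
exists (lsubmx @^-1` W), (fun w => h (lsubmx w)); split=> //.
- by rewrite /= row_mxKl.
- apply: (smoothR_comp oW' oW _ _ sh) => //; exact: smoothrV_sub lsub_smooth.
- by move=> q [dq _] /=; rewrite row_mxKl => Wq; apply: fh.
Qed.

Lemma matrix_chart_rsmooth_entry (p : MB) i j l :
  rsmooth_in matrix_chart (fun q => Phi (tagged q i j) 0 l) p.
Proof.
exists setT, (fun w => rsubmx w 0 (mxvec_index (mxvec_index i j) l)).
split=> //; first exact: openT.
  by apply: smoothrV_rsub; [exact: openT|exact: smoothrV_id].
by move=> q _ _; rewrite /= row_mxKr mxcoordE.
Qed.

Lemma matrix_chart_near (p : MB) P : cdom b (tag p) -> mnear (tag p) P ->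
  near_in matrix_chart p (fun q => P (tag q)).
Proof.
move=> dp /(mnear_adm pD _ (atlas_adm pD ab) dp) [W [oW Wx WP]].
exists (lsubmx @^-1` W); split.
- exact: open_preimT.
- by rewrite /= row_mxKl.
- by move=> q [dq _] /=; rewrite row_mxKl => Wq; apply: WP.
Qed.

End MatrixChart.

(** On the base this is a change of charts of [Delta].  On each fiber it is linear, and
   its coefficients are the coordinates in one trivialization of the sections that
   are constant in the other one. *)
Lemma matrix_chart_change (b b' : chart R Delta) U r Phi Psi U' r' Phi' Psi' :
  atlas b -> atlas b' ->
  @local_trivialization R Delta (fun delta => A delta) E U r Phi Psi ->
  @local_trivialization R Delta (fun delta => A delta) E U' r' Phi' Psi' ->
  smooth_change (matrix_chart b U Phi) (matrix_chart b' U' Phi').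
Proof.
move=> ab ab' hL hL'; have ada := atlas_adm pD ab.
apply: smooth_change_rsmooth; first exact: matrix_chart_is_chart hL.
  apply: (matrix_chart_open ab hL (V := cdom b' `&` U')).
  apply: (mopenI pD); last exact: (triv_open hL').
  exact/(adm_mopen pD)/(atlas_adm pD).
move=> p dp dp' j; case: (split_ordP j) => k ->.
  apply: (@rsmooth_in_eq _ _ _ _ (fun q : MB => b' (tag q) 0 k)).
    by apply: near_inS (near_inT _ _) => q _ /=; rewrite row_mxEl.
  apply: (@matrix_chart_rsmooth_tag b U r Phi (fun d => b' d 0 k)).
  apply/(rsmooth_adm pD) => //; first exact: dp.1.
  by apply: (adm_vsmooth pD); [exact: (atlas_adm pD)|exact: dp'.1].
case/mxvec_indexP: k => k l; case/mxvec_indexP: k => i k.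
apply: (@rsmooth_in_eq _ _ _ _ (fun q : MB => \sum_a
    Phi (tag q) (tagged q i k) 0 a *
    Phi' (tag q) (Psi (tag q) (delta_mx 0 a)) 0 l)).
  have nU' := mopen_mnear pD (triv_open hL') dp'.2.
  have nU := mopen_mnear pD (triv_open hL) dp.2.
  apply: near_inS (matrix_chart_near ab U Phi dp.1 (mnearI pD nU nU')).
  move=> q [Uq U'q] /=.
  rewrite row_mxEr mxcoordE [in RHS](Psi_basis (triv_linear hL Uq) (trivK hL Uq)
    (triv_invK hL Uq) (tagged q i k)).
  rewrite (Phi_sum (triv_linear hL' U'q)) summxE; apply: eq_bigr => a _.
  by rewrite (PhiZ (triv_linear hL' U'q)) mxE.
apply: rsmooth_in_sum => // a _; apply: rsmooth_inM => //.
  exact: matrix_chart_rsmooth_entry.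
apply: (@matrix_chart_rsmooth_tag b U r Phi
  (fun d => Phi' d (Psi d (delta_mx 0 a)) 0 l)).
apply/(rsmooth_adm pD) => //; first exact: dp.1.
have sid := smooth_at_id (tag p) pD.
have sPsi := smooth_at_triv hA hL pD sid dp.2 (delta_mx 0 a).
exact: (vsmooth_triv hA hL' (t := fun d => d) (e := fun d => Psi d (delta_mx 0 a))
  pD dp'.2 sPsi l).
Qed.

Lemma matrix_pre : premanifold MB.
Proof.
split.
- move=> _ [b [U [r [Phi [Psi [ab hL ->]]]]]].
  exact: (matrix_chart_is_chart ab hL).
- move=> p; have [U [r [Phi [Psi [Up hL]]]]] := exists_trivialization hA (tag p).
  have [b [ab _ dp]] := exists_chart pD (tag p).
  by exists (matrix_chart b U Phi) => //; exact: (matrix_chart_atlas ab hL).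
- have cc : forall c c' : chart R MB, atlas c -> atlas c' -> smooth_change c c'.
    move=> c c' [b [U [r [Phi [Psi [ab hL ->]]]]]].
    move=> [b' [U' [r' [Phi' [Psi' [ab' hL' ->]]]]]].
    exact: (matrix_chart_change ab ab' hL hL').
  by move=> c c' ac ac'; split; apply: cc.
Qed.

Lemma exists_matrix_chart d : exists b U r Phi Psi, [/\ atlas b, cdom b d, U d &
  @local_trivialization R Delta (fun delta => A delta) E U r Phi Psi].
Proof.
have [U [r [Phi [Psi [Up hL]]]]] := exists_trivialization hA d.
have [b [ab _ dp]] := exists_chart pD d.
by exists b, U, r, Phi, Psi.
Qed.

Lemma matrix_tag_smooth (p : MB) : smooth_at (fun q : MB => tag q : Delta) p.
Proof.
have [b [U [r [Phi [Psi [ab dp Up hL]]]]]] := exists_matrix_chart (tag p).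
have am := matrix_chart_atlas ab hL.
apply: (smooth_at_atlas matrix_pre ab).
  exists (matrix_chart b U Phi); split=> //.
  by exists setT; split=> // [|q [] //]; exact: openT.
move=> j; exists (matrix_chart b U Phi); split=> //.
apply: (@matrix_chart_rsmooth_tag b U r Phi (fun d => b d 0 j)).
have adb := atlas_adm pD ab.
by apply/(rsmooth_adm pD) => //; apply: (adm_vsmooth pD).
Qed.

(** Points over different points of the base are separated by preimages of open sets
   of the base; points of the same fiber are in a common chart. *)
Lemma matrix_hausdorff : mhausdorff MB.
Proof.
move=> p q pq.
have [b [U [r [Phi [Psi [ab dp Up hL]]]]]] := exists_matrix_chart (tag p).
have [tpq|tpq] := pselect (tag p = tag q).
  apply: (chart_separated matrix_pre (matrix_chart_atlas ab hL)) pq => //.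
  by split; rewrite -tpq.
have [_ _ _ hD _] := base_manifold hA.
have [V [W [oV oW Vp Wq VW]]] := hD _ _ tpq.
have ot (Q : set Delta) : mopen Q -> mopen ([set p | Q (tag p)] : set MB).
  move=> oQ; apply/(mopenP matrix_pre) => x Qx.
  apply: (smooth_at_near pD (matrix_tag_smooth x)); exact: mopen_mnear.
exists [set p | V (tag p)], [set p | W (tag p)]; split=> //; try exact: ot.
apply/seteqP; split=> // x [Vx Wx].
by have : (V `&` W) (tag x); [split|rewrite VW].
Qed.

(** Each basic open set of the base that is contained in the domain of some chart and
   some trivialization gives one chart of the bundle; these charts cover, because
   such sets form a basis. *)
Lemma matrix_second_countable : msecond_countable MB.
Proof.
have [_ _ _ _ [B [oB bB]]] := base_manifold hA.
pose Q n (c : chart R MB) := atlas c /\ forall p : MB, B n (tag p) -> cdom c p.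
pose c n : chart R MB := if pselect (exists c, Q n c) is left e then sval (cid e)
  else Chart set0 (fun=> 0 : 'rV_0).
have cP n : (exists c, Q n c) -> Q n (c n).
  by move=> e; rewrite /c; case: pselect => // e'; case: cid.
apply: (second_countable_of_charts matrix_pre
  (G := [set n | exists c, Q n c]) (c := c)).
  by move=> n /cP [].
move=> p; have [b [U [r [Phi [Psi [ab dp Up hL]]]]]] := exists_matrix_chart (tag p).
have oU : mopen (cdom b `&` U).
  apply: (mopenI pD); last exact: (triv_open hL).
  exact/(adm_mopen pD)/(atlas_adm pD).
have [n [Bn BU]] := bB _ _ oU (conj dp Up).
have Qn : exists c, Q n c.
  exists (matrix_chart b U Phi); split; first exact: matrix_chart_atlas hL.
  by move=> q /BU [].
by exists n => //; apply: (cP n Qn).2.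
Qed.

Lemma matrix_manifold : smooth_manifold MB.
Proof.
have [? ? ?] := matrix_pre.
by split=> //; [exact: matrix_hausdorff|exact: matrix_second_countable].
Qed.

Section Maps.
Variables (P : charted R) (pP : premanifold P).
Variables (U : set Delta) (r : nat) (Phi : forall delta, A delta -> 'rV[R]_r)
  (Psi : forall delta, 'rV[R]_r -> A delta).
Hypothesis hL : @local_trivialization R Delta (fun delta => A delta) E U r Phi Psi.

Lemma smooth_into_matrix (t : P -> Delta) (X : forall y, 'M[A (t y)]_N) (x : P) :
  smooth_at t x -> U (t x) -> mx_smooth Phi x X ->
  smooth_at (fun y => (Tagged (fun delta => 'M[A delta]_N) (X y) : MB)) x.
Proof.
move=> st Ux sX; have [b [ab adb dx]] := exists_chart pD (t x).
have [nb sb] := (smooth_at_adm pP pD adb dx).1 st.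
apply: (smooth_at_atlas pP (matrix_chart_atlas ab hL)).
  exact: (mnearI pP nb (triv_near hA hL st Ux)).
move=> j; case: (split_ordP j) => k ->.
  by apply: rsmooth_ext (sb k) => // y; rewrite /= row_mxEl.
have /(mx_smoothP Phi x pP)/(_ k) := sX.
by apply: rsmooth_ext => // y; rewrite /= row_mxEr.
Qed.

Lemma smooth_matrix_entries (e : P -> MB) (x : P) :
  smooth_at e x -> U (tag (e x)) ->
  mx_smooth Phi (t := fun y => tag (e y)) x (fun y => tagged (e y)).
Proof.
move=> se Ux i j l.
apply: (smooth_at_rsmooth matrix_pre se
  (g := fun q : MB => Phi (tagged q i j) 0 l)).
have [b [ab _ dx]] := exists_chart pD (tag (e x)).
exists (matrix_chart b U Phi); split=> //; first exact: matrix_chart_atlas hL.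
exact: matrix_chart_rsmooth_entry.
Qed.

End Maps.
End MatrixBundle.

(** * The family of general linear groups *)

Section GLFamily.
Variables (R : realType) (Delta : charted R).
Variables (A : Delta -> algebra R) (E : set (chart R {delta & A delta})).
Hypothesis hA : smooth_family_of_algebras E.
Variable N : nat.

Local Notation MB := (total (matrix_bundle E N)).
Local Notation GLN := (fun delta => GL (A delta) N).
Local Notation GLF := (total (GL_family E N)).
Let pD := base_pre hA.
Let pMB := matrix_pre hA N.

(** The map that defines [GL_family]. *)
Definition GL_incl (g : {delta & GL (A delta) N}) : MB :=
  Tagged (fun delta => 'M[A delta]_N) (sval (tagged g)).

Lemma GL_incl_inj : injective GL_incl.
Proof.
move=> [d g] [d' h] gh; have dd' : d = d' := congr1 tag gh; subst d'.
by have := Tagged_inj gh => /= /GL_inj ->.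
Qed.

Lemma range_GL_incl p : range GL_incl p <-> invertible (tagged p).
Proof.
split=> [[g _ <-]|ip]; first exact: (svalP (tagged g)).
by exists (Tagged GLN (exist _ (tagged p) ip)) => //; case: p ip.
Qed.

Lemma GL_open : mopen (range GL_incl).
Proof.
apply/(mopenP pMB) => p /range_GL_incl ip.
have [U [r [Phi [Psi [Up hL]]]]] := exists_trivialization hA (tag p).
have sX := smooth_matrix_entries hA hL (smooth_at_id p pMB) Up.
have := mx_invertible_near hA hL pMB (matrix_tag_smooth hA p) Up sX ip.
by apply: mnearS => q iq; apply/range_GL_incl.
Qed.

Section Charts.
Variables (b : chart R Delta) (ab : atlas b).
Variables (U : set Delta) (r : nat) (Phi : forall delta, A delta -> 'rV[R]_r)
  (Psi : forall delta, 'rV[R]_r -> A delta).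
Hypothesis hL : @local_trivialization R Delta (fun delta => A delta) E U r Phi Psi.

Let D := cdom (matrix_chart E N b U Phi) `&` range GL_incl.
Let phi (p : MB) := row_mx (matrix_chart E N b U Phi p) (0 : 'rV[R]_0).

(** As the general linear groups form an open subset, no coordinate has to vanish on
   it. *)
Lemma GL_slice : slice_chart (range GL_incl) D phi.
Proof.
have am := atlas_adm pMB (matrix_chart_atlas N ab hL).
split=> [|p [_ Gp]]; last by split=> // _; rewrite row_mxKr.
have sid d : smoothrV setT (@id 'rV[R]_d) by exact: smoothrV_id.
apply: (@adm_transport _ MB (matrix_chart E N b U Phi) _ _
  (fun w => row_mx w 0) lsubmx
  pMB am).
- by apply: (smoothrV_row openT) => //; exact: smoothrV_cst.
- exact: (smoothrV_lsub openT).
- by move=> w; rewrite row_mxKl.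
- by move=> w; rewrite -[RHS]hsubmxK; congr row_mx; apply/rowP => -[].
- by apply: (mopenI pMB); [exact: (adm_mopen pMB)|exact: GL_open].
- by move=> p [].
Qed.

Definition GL_coord (g : GLF) : 'rV[R]_(N * N * r) :=
  mxcoord (Phi (delta := tag g)) (sval (tagged g)).

Lemma GL_adapted : adapted (F := GLN) (cdom b `&` U) b GL_coord.
Proof.
split=> //.
exists _, _, D, phi; split; first exact: GL_slice.
have -> : GL_incl @^-1` D = [set g | (cdom b `&` U) (tag g)].
  apply/seteqP; split=> g; first by case.
  by move=> gU; split=> //; exists g.
congr Chart; apply/funext => g.
by rewrite /phi row_mxKl.
Qed.

End Charts.

Lemma GL_submanifold : submanifold (range GL_incl).
Proof.
move=> p Gp.
have [b [U [r [Phi [Psi [ab dp Up hL]]]]]] := exists_matrix_chart hA (tag p).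
exists (cdim (matrix_chart E N b U Phi)), 0%N,
  (cdom (matrix_chart E N b U Phi) `&` range GL_incl),
  (fun q => row_mx (matrix_chart E N b U Phi q) 0).
by split; [|exact: (GL_slice ab hL)].
Qed.

Lemma GL_manifold : smooth_manifold GLF.
Proof.
have [_ _ _ hM cM] := matrix_manifold hA N.
exact: (induced_manifold pMB GL_incl_inj GL_submanifold hM cM).
Qed.

Let pG := smooth_premanifold GL_manifold.

Lemma GL_locally_adapted d : exists (V : set Delta) m b (z : GLF -> 'rV[R]_m),
  V d /\ adapted (F := GLN) V b z.
Proof.
have [b [U [r [Phi [Psi [ab dp Up hL]]]]]] := exists_matrix_chart hA d.
exists (cdom b `&` U), _, b, (GL_coord Phi); split=> //.
exact: (GL_adapted ab hL).
Qed.

Lemma smooth_GL_incl (g : GLF) : smooth_at (GL_incl : GLF -> MB) g.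
Proof. exact: (smooth_induced_map pMB GL_incl_inj GL_submanifold). Qed.

(** A map to the total space is smooth if its projection to the base and its entries
   are; the trivialization is left to be chosen by the lemma. *)
Lemma smooth_into_GL (P : charted R) (t : P -> Delta) (g : forall y, GL (A (t y)) N)
    (x : P) : premanifold P -> smooth_at t x ->
  (forall U r Phi Psi,
    @local_trivialization R Delta (fun delta => A delta) E U r Phi Psi ->
    U (t x) -> mx_smooth Phi x (fun y => sval (g y))) ->
  smooth_at (fun y => (Tagged GLN (g y) : GLF)) x.
Proof.
move=> pP st sg.
have [U [r [Phi [Psi [Up hL]]]]] := exists_trivialization hA (t x).
apply: (smooth_into_induced (i := GL_incl) pMB GL_submanifold pP).
exact: (smooth_into_matrix hA pP hL st Up (sg _ _ _ _ hL Up)).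
Qed.

Lemma smooth_GL_entries (P : charted R) (e : P -> GLF) (x : P) U r Phi Psi :
  premanifold P ->
  @local_trivialization R Delta (fun delta => A delta) E U r Phi Psi ->
  smooth_at e x -> U (tag (e x)) ->
  mx_smooth Phi (t := fun y => tag (e y)) x (fun y => sval (tagged (e y))).
Proof.
move=> pP hL se Ux.
have sie := smooth_at_comp pP pG pMB se (smooth_GL_incl (e x)).
exact: (smooth_matrix_entries hA hL sie Ux).
Qed.

Lemma GL_family_one :
  smooth (fun d : Delta => (Tagged GLN (1%g : GL (A d) N) : GLF)).
Proof.
move=> d; apply: (smooth_into_GL (t := fun d => d)) => //.
  exact: smooth_at_id.
move=> U r Phi Psi hL Ud; exact: (mx_smooth1 hA hL pD (smooth_at_id d pD) Ud).
Qed.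

Lemma GL_family_inv :
  smooth (fun g : GLF => (Tagged GLN (tagged g)^-1%g : GLF)).
Proof.
move=> g; have st := tag_smooth (F := GLN) pG GL_locally_adapted g.
apply: (smooth_into_GL (t := fun g : GLF => tag g)) => // U r Phi Psi hL Ug.
have sX := smooth_GL_entries pG hL (smooth_at_id g pG) Ug.
apply: (mx_smooth_inv hA hL pG st Ug sX) => h.
exact: (congr1 sval (mulgV (tagged h))).
Qed.

Let pF := fibered_square_pre (F := GLN) pD pG GL_locally_adapted.

Lemma GL_family_mul :
  smooth (fun p : fibered_square (F := GLN) (GL_family E N) =>
    (Tagged GLN ((tagged p).1 * (tagged p).2)%g : GLF)).
Proof.
move=> p; pose j := @fibered_pair R Delta GLN (GL_family E N).
have sj : smooth_at (j : fibered_square (F := GLN) (GL_family E N) -> _) p.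
  apply: (smooth_induced_map (product_pre pG pG)).
    exact: fibered_pair_inj.
  exact: (fibered_pair_submanifold pD pG GL_locally_adapted).
have pGG := product_pre pG pG.
have s1 := smooth_at_comp pF pGG pG sj (smooth_fst pG pG (j p)).
have s2 := smooth_at_comp pF pGG pG sj (smooth_snd pG pG (j p)).
have st := smooth_at_comp pF pG pD s1
  (tag_smooth (F := GLN) pG GL_locally_adapted _).
apply: (smooth_into_GL pF st) => U r Phi Psi hL Up.
exact: (mx_smooth_mul hA hL pF st Up (smooth_GL_entries pF hL s1 Up)
  (smooth_GL_entries pF hL s2 Up)).
Qed.

Lemma GL_fiber_lie d :
  @lie_group R (GL (A d) N) (@atlas R (fiber (F := GLN) (GL_family E N) d)).
Proof.
pose Fb := fiber (F := GLN) (GL_family E N) d.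
pose i := @fiber_incl R Delta GLN (GL_family E N) d.
have sub_i : submanifold (range i).
  exact: (fiber_submanifold pD pG GL_locally_adapted).
have inj_i : injective i by exact: Tagged_inj.
have mF : smooth_manifold Fb.
  exact: (fiber_manifold pD pG GL_locally_adapted d GL_manifold).
have pFb := smooth_premanifold mF.
have si (x : Fb) : smooth_at (i : Fb -> GLF) x by exact: (smooth_induced_map pG).
have pP := product_pre pFb pFb.
split; first exact: mF.
- move=> p; apply: (smooth_into_induced (i := i) pG sub_i pP).
  have st := smooth_at_cst d p pP pD.
  apply: (smooth_into_GL (t := fun=> d) pP st) => U r Phi Psi hL Up.
  have s1 := smooth_at_comp pP pFb pG (smooth_fst pFb pFb p) (si _).
  have s2 := smooth_at_comp pP pFb pG (smooth_snd pFb pFb p) (si _).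
  exact: (mx_smooth_mul hA hL pP st Up (smooth_GL_entries pP hL s1 Up)
    (smooth_GL_entries pP hL s2 Up)).
- move=> g; apply: (smooth_into_induced (i := i) pG sub_i pFb).
  have st := smooth_at_cst d (g : Fb) pFb pD.
  apply: (smooth_into_GL (t := fun=> d) pFb st) => U r Phi Psi hL Up.
  apply: (mx_smooth_inv hA hL pFb st Up (smooth_GL_entries pFb hL (si g) Up)) => h.
  exact: (congr1 sval (mulgV h)).
Qed.

Lemma GL_family_groups :
  @smooth_family_of_groups R Delta (fun d => GL (A d) N) (GL_family E N).
Proof.
split.
- split; [exact: base_manifold hA|exact: GL_manifold|].
  exact: (tag_submersion pD pG GL_locally_adapted).
- exact: GL_family_one.
- exact: GL_family_mul.
- exact: GL_family_inv.
- exact: GL_fiber_lie.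
Qed.

End GLFamily.

(** * The stabilizers and the family of geometries *)

Section Stabilizer.
Variables (R : realType) (A : algebra R) (r : nat).
Variables (Phi : A -> 'rV[R]_r) (Psi : 'rV[R]_r -> A).
Hypotheses (linPhi : linear Phi) (PhiK : cancel Phi Psi) (PsiK : cancel Psi Phi).
Variable n : nat.
Implicit Types g h : GL A (n + 1).

(** Comparing blocks in [g *m h = 1%:M] shows that the upper left block of [h] is a
   right inverse, hence an inverse, of that of [g]. *)
Lemma ursubmx_inv (g h : 'M[A]_(n + 1)) : g *m h = 1%:M -> ursubmx g = 0 ->
  [/\ ulsubmx g *m ulsubmx h = 1%:M, ulsubmx h *m ulsubmx g = 1%:M & ursubmx h = 0].
Proof.
move=> gh g0; move: gh; rewrite -[g]submxK -[h]submxK g0 mulmx_block.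
rewrite scalar_mx_block => /eq_block_mx [XP XQ _ _].
rewrite !(block_mxKul, block_mxKur).
have XP1 : ulsubmx g *m ulsubmx h = 1%:M by rewrite -XP mul0mx addr0.
have PX1 : ulsubmx h *m ulsubmx g = 1%:M := mulmx_rinv_linv linPhi PhiK PsiK XP1.
split=> //; rewrite -[LHS]mul1mx -PX1 -mulmxA.
by move: XQ; rewrite mul0mx addr0 => ->; rewrite mulmx0.
Qed.

(** By [ursubmx_inv] the upper right block of the inverse vanishes as well, so that
   the diagonal blocks of the inverse are inverse to those of [g].
   Over an arbitrary ring the diagonal blocks of an invertible matrix of this shape
   may fail to be invertible. *)
Lemma St_ursubmx g : @St A n g <-> ursubmx (sval g) = 0.
Proof.
split=> [[X [v [a [_ _ ->]]]]|g0]; first by rewrite block_mxKur.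
have [h [hg gh]] := svalP g.
have [XP PX h0] := ursubmx_inv gh g0.
have a1 (B : 'M[A]_1) : B = (B 0 0)%:M by exact: mx11_scalar.
exists (ulsubmx (sval g)), (dlsubmx (sval g)), (drsubmx (sval g) 0 0); split.
- by exists (ulsubmx h).
- have E1 : drsubmx h *m drsubmx (sval g) = 1%:M.
    have : h *m sval g = 1%:M by [].
    rewrite -[h]submxK -[sval g]submxK g0 h0 mulmx_block scalar_mx_block.
    move=> /eq_block_mx [_ _ _].
    by rewrite !(block_mxKdr) mulmx0 add0r.
  have E2 : drsubmx (sval g) *m drsubmx h = 1%:M.
    have : sval g *m h = 1%:M by [].
    rewrite -[h]submxK -[sval g]submxK g0 h0 mulmx_block scalar_mx_block.
    move=> /eq_block_mx [_ _ _].
    by rewrite !(block_mxKdr) mulmx0 add0r.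
  exists (drsubmx h 0 0); split.
    by have /matrixP/(_ 0 0) := E1; rewrite mxE big_ord1 => ->; rewrite mxE eqxx.
  by have /matrixP/(_ 0 0) := E2; rewrite mxE big_ord1 => ->; rewrite mxE eqxx.
- by rewrite -a1 -g0 submxK.
Qed.

Lemma St_subgroup : is_subgroup (@St A n : set (GL A (n + 1))).
Proof.
split.
- apply/St_ursubmx => /=; have -> : (1 : 'M[A]_(n + 1)) = 1%:M by [].
  by rewrite scalar_mx_block block_mxKur.
- move=> g h /St_ursubmx g0 /St_ursubmx h0; apply/St_ursubmx => /=.
  have -> : sval g * sval h = sval g *m sval h by [].
  rewrite -[sval g]submxK -[sval h]submxK g0 h0 mulmx_block block_mxKur.
  by rewrite mulmx0 mul0mx addr0.
- move=> g /St_ursubmx g0; apply/St_ursubmx.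
  by have [] := ursubmx_inv (congr1 sval (mulgV g)) g0.
Qed.

(** The positions of the coordinates of the upper right block. *)
Definition ur_index (il : 'I_n * 'I_r) : 'I_((n + 1) * (n + 1) * r) :=
  mxvec_index (mxvec_index (lshift 1 il.1) (rshift n 0)) il.2.

Lemma St_coord g : @St A n g <->
  forall j, j \in [set ur_index il | il : 'I_n * 'I_r] ->
    mxcoord Phi (sval g) 0 j = 0.
Proof.
apply: (iff_trans (St_ursubmx g)); split=> [g0 _ /imsetP [[i l] _ ->]|H].
  rewrite mxcoordE; have /matrixP/(_ i 0) := g0; rewrite !mxE => ->.
  by rewrite (Phi0 linPhi) mxE.
apply/matrixP => i j; rewrite (ord1 j) !mxE; apply: (can_inj PhiK).
apply/rowP => l; rewrite (Phi0 linPhi) mxE -mxcoordE.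
by apply: H; apply/imsetP; exists (i, l).
Qed.

End Stabilizer.

Section Main.
Variables (R : realType) (Delta : charted R).
Variables (A : Delta -> algebra R) (E : set (chart R {delta & A delta})).
Hypothesis hA : smooth_family_of_algebras E.
Variable n : nat.

Lemma St_closed_subfamily :
  @closed_subfamily R Delta (fun d => GL (A d) (n + 1)) (GL_family E (n + 1))
    (fun d => @St (A d) n).
Proof.
apply: coordinate_subfamily.
- exact: base_pre hA.
- exact/smooth_premanifold/(GL_manifold hA).
move=> d; have [b [U [r [Phi [Psi [ab dp Up hL]]]]]] := exists_matrix_chart hA d.
exists (cdom b `&` U), _, b, (GL_coord (N := n + 1) Phi),
  [set ur_index il | il : 'I_n * 'I_r]; split=> //.
  exact: (GL_adapted hA _ ab hL).
move=> p [_ Up']; apply: St_coord.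
- exact: (triv_linear hL).
- exact: (trivK hL).
- exact: (triv_invK hL).
Qed.

End Main.

Theorem mainTheorem18 (R : realType) (Delta : charted R)
    (A : Delta -> algebra R) (E : set (chart R {delta : Delta & A delta}))
    (hA : smooth_family_of_algebras E) (n : nat) :
  smooth_family_of_geometries (P := fun delta => projective_geometry (A delta) n)
    (GL_family E (n + 1)).
Proof.
split.
- exact: GL_family_groups.
- exact: St_closed_subfamily.
- move=> d; have [U [r [Phi [Psi [Ud hL]]]]] := exists_trivialization hA d.
  exact: (St_subgroup (triv_linear hL Ud) (trivK hL Ud) (triv_invK hL Ud)).
Qed.
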